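(* Let $G$ be a finite group and let $T,R$ be two levelwise finitely generated $G$-Tambara functors. Then $T\boxtimes R$ is levelwise finitely generated.
   Context: Let $G$ be a finite group. The category $\mathcal{P}_G$ of bispans (polynomials) has finite $G$-sets as objects; a morphism $X\to Y$ is an isomorphism class of diagrams $[X\xleftarrow{p}A\xrightarrow{q}B\xrightarrow{r}Y]$ of finite $G$-sets (isomorphisms are pairs $A\cong A'$, $B\cong B'$ compatible with all maps and the identity on $X,Y$). The composite of $[X\leftarrow A\to B\xrightarrow{r}Y]$ followed by $[Y\xleftarrow{p'}A'\xrightarrow{q'}B'\to Z]$ is $[X\leftarrow A''\to B''\to Z]$ with $B''=\{(b',s): b'\in B',\ s:q'^{-1}(b')\to B,\ r s=p'\}$, $W=B''\times_{B'}A'$, $W\to B$ given by $(a',s)\mapsto s(a')$, and $A''=W\times_B A$. A $G$-Tambara functor is a product-preserving functor $\mathcal{P}_G\to\mathrm{Set}$ (products in $\mathcal{P}_G$ are disjoint unions) whose values, which are canonically commutative semirings, are rings. A $G$-Tambara functor $T$ is levelwise finitely generated if $T(G/H)$ is a finitely generated $\mathbb{Z}$-algebra for every $H\leq G$ (equivalently, a finite-type algebra over the Burnside ring $\mathbb{A}(G/H)$ of $H$ for every $H\le G$, via the unique map from the initial Tambara functor $\mathbb{A}$). The box product $T\boxtimes R$ is Day convolution of the underlying Mackey functors with its canonical Tambara structure; it is the coproduct of $T$ and $R$ in the category of $G$-Tambara functors. *)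

(* Defs.v *)
From mathcomp Require Import all_boot all_fingroup.

Set Implicit Arguments.
Unset Strict Implicit.
Unset Printing Implicit Defensive.

(* Actions are right actions, as in MathComp; inverting group elements        *)
(* identifies the category of right G-sets with that of left G-sets, and      *)
(* turns the right cosets H \ G into the left cosets G / H.                   *)
Record gset (gT : finGroupType) := GSet {
  gset_car :> finType;
  gact : {action gT &-> gset_car}
}.

Record gmap (gT : finGroupType) (X Y : gset gT) := GMap {
  gmap_fun :> X -> Y;
  gmapP : forall x g, gmap_fun (gact X x g) = gact Y (gmap_fun x) g
}.

Section GSets.
Variable gT : finGroupType.
Implicit Types X Y Z : gset gT.

Definition gmap_id X : gmap X X :=
  @GMap gT X X id (fun x g => erefl).

Definition gmap_comp X Y Z (g : gmap Y Z) (f : gmap X Y) : gmap X Z.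
Proof. by exists (g \o f) => x a /=; rewrite !gmapP. Defined.

Definition gempty_act (x : void) (g : gT) : void := x.
Fact gempty_act1 : gempty_act^~ 1%g =1 id. Proof. by []. Qed.
Fact gempty_actM x : act_morph gempty_act x. Proof. by []. Qed.
Definition gempty : gset gT := GSet (TotalAction gempty_act1 gempty_actM).

Definition gempty_map X : gmap gempty X.
Proof. by exists (fun x : void => match x with end) => -[]. Defined.

Section Sum.
Variables X Y : gset gT.
Definition gsum_act (u : X + Y) (g : gT) : X + Y :=
  match u with inl x => inl (gact X x g) | inr y => inr (gact Y y g) end.
Fact gsum_act1 : gsum_act^~ 1%g =1 id.
Proof. by case=> x /=; rewrite act1. Qed.
Fact gsum_actM u : act_morph gsum_act u.
Proof. by case: u => x a b /=; rewrite actM. Qed.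
Definition gsum : gset gT := GSet (TotalAction gsum_act1 gsum_actM).
Definition ginl : gmap X gsum := @GMap gT X gsum inl (fun x g => erefl).
Definition ginr : gmap Y gsum := @GMap gT Y gsum inr (fun y g => erefl).
End Sum.

Definition gfold X : gmap (gsum X X) X.
Proof. by exists (fun u : X + X => match u with inl x | inr x => x end) => -[]. Defined.

Section Prod.
Variables X Y : gset gT.
Definition gprod_act (u : X * Y) (g : gT) : X * Y :=
  (gact X u.1 g, gact Y u.2 g).
Fact gprod_act1 : gprod_act^~ 1%g =1 id.
Proof. by case=> x y; rewrite /gprod_act /= !act1. Qed.
Fact gprod_actM u : act_morph gprod_act u.
Proof. by move=> a b; rewrite /gprod_act /= !actM. Qed.
Definition gprod : gset gT := GSet (TotalAction gprod_act1 gprod_actM).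
Definition gfst : gmap gprod X := @GMap gT gprod X fst (fun u g => erefl).
Definition gsnd : gmap gprod Y := @GMap gT gprod Y snd (fun u g => erefl).
End Prod.

Definition gprod_map X X' Y Y' (f : gmap X X') (g : gmap Y Y') :
  gmap (gprod X Y) (gprod X' Y').
Proof.
exists (fun u : X * Y => (f u.1, g u.2) : gprod X' Y') => u a.
by rewrite /= !gmapP.
Defined.

Section Sub.
Variables (X : gset gT) (P : pred X).
Hypothesis PJ : forall x g, P x -> P (gact X x g).
Definition gsub_act (u : {x : X | P x}) (g : gT) : {x : X | P x} :=
  exist _ (gact X (val u) g) (PJ g (valP u)).
Fact gsub_act1 : gsub_act^~ 1%g =1 id.
Proof. by move=> u; apply: val_inj; rewrite /= act1. Qed.
Fact gsub_actM u : act_morph gsub_act u.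
Proof. by move=> a b; apply: val_inj; rewrite /= actM. Qed.
Definition gsub : gset gT := GSet (TotalAction gsub_act1 gsub_actM).
Definition gsub_val : gmap gsub X :=
  @GMap gT gsub X (fun u : {x : X | P x} => val u) (fun u g => erefl).
End Sub.

(* G acts on partial functions A -> B by conjugation; [s a = None] means that *)
(* [s] is undefined at [a].                                                   *)
Section PartialMaps.
Variables A B : gset gT.
Definition gpfun_act (s : {ffun A -> option B}) (g : gT) : {ffun A -> option B} :=
  [ffun a => omap (fun b => gact B b g) (s (gact A a g^-1%g))].
Fact gpfun_act1 : gpfun_act^~ 1%g =1 id.
Proof.
move=> s; apply/ffunP=> a; rewrite ffunE invg1 act1.
by case: (s a) => //= b; rewrite act1.
Qed.
Fact gpfun_actM s : act_morph gpfun_act s.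
Proof.
move=> g h; apply/ffunP=> a; rewrite !ffunE invMg actM.
by case: (s _) => //= b; rewrite actM.
Qed.
Definition gpfun : gset gT := GSet (TotalAction gpfun_act1 gpfun_actM).
End PartialMaps.

Section Orbit.
Variable H : {group gT}.
(* MathComp's ['Rs] is right translation of subsets of G. *)
Definition gset_of_sets : gset gT := @GSet gT {set gT} 'Rs%act.
Fact orbit_closed (C : gset_of_sets) g :
  C \in rcosets H [set: gT] -> gact gset_of_sets C g \in rcosets H [set: gT].
Proof.
by case/rcosetsP=> x _ ->; rewrite /= rcosetE -rcosetM; apply/rcosetsP; exists (x * g)%g; rewrite ?inE.
Qed.
Definition gorbit : gset gT := gsub orbit_closed.
End Orbit.

End GSets.

Record bispan (gT : finGroupType) (X Y : gset gT) := Bispan {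
  bsA : gset gT;
  bsB : gset gT;
  bsp : gmap bsA X;
  bsq : gmap bsA bsB;
  bsr : gmap bsB Y
}.

Section Bispans.
Variable gT : finGroupType.
Implicit Types X Y Z : gset gT.

Definition bispan_iso X Y (b c : bispan X Y) : Prop :=
  exists (f : gmap (bsA b) (bsA c)) (g : gmap (bsB b) (bsB c)),
    [/\ bijective f, bijective g &
        [/\ forall a, bsp c (f a) = bsp b a,
            forall a, bsq c (f a) = g (bsq b a) &
            forall y, bsr c (g y) = bsr b y]].

Definition bispan_id X : bispan X X :=
  Bispan (gmap_id X) (gmap_id X) (gmap_id X).

Section Comp.
Variables (X Y Z : gset gT) (b : bispan X Y) (c : bispan Y Z).

(* For b = [X <-p- A -q-> B -r-> Y] and c = [Y <-p'- A' -q'-> B' -r'-> Z]:     *)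
(* [comp_B] consists of the pairs (b', s) with s : q'^-1(b') -> B and         *)
(* r s = p', the section s being encoded as a partial function on A' whose    *)
(* domain is the fibre q'^-1(b'); [comp_W] is the pullback of [comp_B] and A' *)
(* over B'; [comp_A] is the pullback of [comp_W] and A over B, where          *)
(* ((b', s), a') is sent to s(a').                                            *)
Definition comp_secP (u : gprod (bsB c) (gpfun (bsA c) (bsB b))) : bool :=
  [forall a', omap (bsr b) (u.2 a') ==
              if bsq c a' == u.1 then Some (bsp c a') else None].
Fact comp_secJ u g : comp_secP u -> comp_secP (gact _ u g).
Proof.
move/forallP=> Hu; apply/forallP=> a'; move/eqP: (Hu (gact _ a' g^-1%g)) => /=.
rewrite ffunE !gmapP.
have -> : (gact _ (bsq c a') g^-1%g == u.1) = (bsq c a' == gact _ u.1 g).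
  apply/eqP/eqP=> [<-|->]; first by rewrite -actM mulVg act1.
  by rewrite -actM mulgV act1.
case: (u.2 _) => [y|] /=; case: ifP => //= _ [E]; rewrite gmapP E.
by rewrite -actM mulVg act1.
Qed.
Definition comp_B : gset gT := gsub comp_secJ.
Definition comp_WP (w : gprod comp_B (bsA c)) : bool :=
  (val w.1).1 == bsq c w.2.
Fact comp_WJ w g : comp_WP w -> comp_WP (gact _ w g).
Proof. by move/eqP=> E; apply/eqP; rewrite /= gmapP E. Qed.
Definition comp_W : gset gT := gsub comp_WJ.
Definition comp_AP (v : gprod comp_W (bsA b)) : bool :=
  let: ((_, s), a') := (val (val v.1).1, (val v.1).2) in
  s a' == Some (bsq b v.2).
Fact comp_AJ v g : comp_AP v -> comp_AP (gact _ v g).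
Proof.
case: v => [[[[[b' s] Hs] a'] Hw] a]; rewrite /comp_AP /= => /eqP E.
by rewrite ffunE -actM mulgV act1 E /= gmapP.
Qed.
Definition comp_A : gset gT := gsub comp_AJ.

Definition bispan_comp : bispan X Z :=
  @Bispan gT X Z comp_A comp_B
    (gmap_comp (bsp b) (gmap_comp (gsnd _ _) (gsub_val comp_AJ)))
    (gmap_comp (gmap_comp (gfst _ _) (gsub_val comp_WJ))
               (gmap_comp (gfst _ _) (gsub_val comp_AJ)))
    (gmap_comp (bsr c) (gmap_comp (gfst _ _) (gsub_val comp_secJ))).
End Comp.

Definition bres X Y (f : gmap X Y) : bispan Y X :=
  Bispan f (gmap_id X) (gmap_id X).
Definition bnorm X Y (f : gmap X Y) : bispan X Y :=
  Bispan (gmap_id X) f (gmap_id Y).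
Definition btr X Y (f : gmap X Y) : bispan X Y :=
  Bispan (gmap_id X) (gmap_id X) f.

End Bispans.

Record span (gT : finGroupType) (X Y : gset gT) := Span {
  spS : gset gT;
  spl : gmap spS X;
  spr : gmap spS Y
}.

Section Spans.
Variable gT : finGroupType.
Implicit Types X Y Z : gset gT.

Definition span_iso X Y (s t : span X Y) : Prop :=
  exists f : gmap (spS s) (spS t),
    [/\ bijective f, forall x, spl t (f x) = spl s x &
        forall x, spr t (f x) = spr s x].

Definition span_id X : span X X := Span (gmap_id X) (gmap_id X).

Section Comp.
Variables (X Y Z : gset gT) (s : span X Y) (t : span Y Z).
Definition span_pbP (u : gprod (spS s) (spS t)) : bool := spr s u.1 == spl t u.2.
Fact span_pbJ u g : span_pbP u -> span_pbP (gact _ u g).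
Proof. by move/eqP=> E; apply/eqP; rewrite /= !gmapP E. Qed.
Definition span_comp : span X Z :=
  @Span gT X Z (gsub span_pbJ)
    (gmap_comp (spl s) (gmap_comp (gfst _ _) (gsub_val span_pbJ)))
    (gmap_comp (spr t) (gmap_comp (gsnd _ _) (gsub_val span_pbJ))).
End Comp.

Definition span_prod X X' Y Y' (s : span X X') (t : span Y Y') :
    span (gprod X Y) (gprod X' Y') :=
  Span (gprod_map (spl s) (spl t)) (gprod_map (spr s) (spr t)).

Definition sres X Y (f : gmap X Y) : span Y X := Span f (gmap_id X).
Definition str X Y (f : gmap X Y) : span X Y := Span (gmap_id X) f.

Definition bispan_of_span X Y (s : span X Y) : bispan X Y :=
  Bispan (spl s) (gmap_id (spS s)) (spr s).

End Spans.

(* A product-preserving functor to sets from the category of isomorphism      *)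
(* classes of spans, given on representatives.  Products of spans are         *)
(* disjoint unions, with the restrictions along the inclusions as             *)
(* projections; [sm_pair] is the inverse of M(X + Y) -> M(X) * M(Y).          *)
Record semi_mackey (gT : finGroupType) := SemiMackey {
  sm_obj :> gset gT -> Type;
  sm_map : forall X Y, span X Y -> sm_obj X -> sm_obj Y;
  sm_iso : forall X Y (s t : span X Y), span_iso s t -> sm_map s =1 sm_map t;
  sm_id : forall X, sm_map (span_id X) =1 id;
  sm_comp : forall X Y Z (s : span X Y) (t : span Y Z) x,
    sm_map (span_comp s t) x = sm_map t (sm_map s x);
  sm_pt : sm_obj (gempty gT);
  sm_ptP : forall x : sm_obj (gempty gT), x = sm_pt;
  sm_pair : forall X Y, sm_obj X -> sm_obj Y -> sm_obj (gsum X Y);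
  sm_pairl : forall X Y x y, sm_map (sres (ginl X Y)) (sm_pair x y) = x;
  sm_pairr : forall X Y x y, sm_map (sres (ginr X Y)) (sm_pair x y) = y;
  sm_pairK : forall X Y (z : sm_obj (gsum X Y)),
    sm_pair (sm_map (sres (ginl X Y)) z) (sm_map (sres (ginr X Y)) z) = z
}.

Definition sm_zero gT (M : semi_mackey gT) (X : gset gT) : M X :=
  sm_map (str (gempty_map X)) (sm_pt M).
Definition sm_add gT (M : semi_mackey gT) (X : gset gT) (x y : M X) : M X :=
  sm_map (str (gfold X)) (sm_pair x y).

Record mackey (gT : finGroupType) := Mackey {
  mackey_base :> semi_mackey gT;
  mackey_opp : forall X (x : mackey_base X), exists y, sm_add x y = sm_zero _ X
}.

Record mackey_hom gT (M N : semi_mackey gT) := MackeyHom {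
  mh_fun :> forall X, M X -> N X;
  mh_nat : forall X Y (s : span X Y) (x : M X),
    mh_fun (sm_map s x) = sm_map s (mh_fun x)
}.

(* A family M(X) * N(Y) -> P(X * Y) natural in X and Y with respect to spans. *)
(* Such a family is automatically biadditive, since addition is transfer      *)
(* along a fold map.                                                          *)
Definition pairing gT (M N P : semi_mackey gT) :=
  forall X Y : gset gT, M X -> N Y -> P (gprod X Y).

Definition natural_pairing gT (M N P : semi_mackey gT) (phi : pairing M N P) :=
  forall X X' Y Y' (s : span X X') (t : span Y Y') (m : M X) (n : N Y),
    phi X' Y' (sm_map s m) (sm_map t n) = sm_map (span_prod s t) (phi X Y m n).

(* [phi] exhibits D as the left Kan extension of                              *)
(* (X, Y) |-> M(X) (x) N(Y) along the product (X, Y) |-> X * Y.               *)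
Definition is_day_convolution gT (M N D : mackey gT) (phi : pairing M N D) :=
  natural_pairing phi /\
  forall (P : mackey gT) (psi : pairing M N P), natural_pairing psi ->
    exists h : mackey_hom D P,
      (forall X Y m n, h _ (phi X Y m n) = psi X Y m n) /\
      forall h' : mackey_hom D P,
        (forall X Y m n, h' _ (phi X Y m n) = psi X Y m n) ->
        forall X d, h' X d = h X d.

(* A product-preserving functor to sets from the category of isomorphism      *)
(* classes of bispans, given on representatives; [st_pair] is the inverse of  *)
(* T(X + Y) -> T(X) * T(Y).                                                   *)
Record semi_tambara (gT : finGroupType) := SemiTambara {
  st_obj :> gset gT -> Type;
  st_map : forall X Y, bispan X Y -> st_obj X -> st_obj Y;
  st_iso : forall X Y (b c : bispan X Y), bispan_iso b c -> st_map b =1 st_map c;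
  st_id : forall X, st_map (bispan_id X) =1 id;
  st_comp : forall X Y Z (b : bispan X Y) (c : bispan Y Z) x,
    st_map (bispan_comp b c) x = st_map c (st_map b x);
  st_pt : st_obj (gempty gT);
  st_ptP : forall x : st_obj (gempty gT), x = st_pt;
  st_pair : forall X Y, st_obj X -> st_obj Y -> st_obj (gsum X Y);
  st_pairl : forall X Y x y, st_map (bres (ginl X Y)) (st_pair x y) = x;
  st_pairr : forall X Y x y, st_map (bres (ginr X Y)) (st_pair x y) = y;
  st_pairK : forall X Y (z : st_obj (gsum X Y)),
    st_pair (st_map (bres (ginl X Y)) z) (st_map (bres (ginr X Y)) z) = z
}.

Section SemiRing.
Variables (gT : finGroupType) (T : semi_tambara gT) (X : gset gT).
Implicit Types x y : T X.
Definition st_zero : T X := st_map (btr (gempty_map X)) (st_pt T).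
Definition st_one : T X := st_map (bnorm (gempty_map X)) (st_pt T).
Definition st_add x y : T X := st_map (btr (gfold X)) (st_pair x y).
Definition st_mul x y : T X := st_map (bnorm (gfold X)) (st_pair x y).
End SemiRing.

Record tambara (gT : finGroupType) := Tambara {
  tambara_base :> semi_tambara gT;
  tambara_opp : forall X (x : tambara_base X),
    exists y, st_add x y = st_zero _ X
}.

Record tambara_hom gT (T R : semi_tambara gT) := TambaraHom {
  th_fun :> forall X, T X -> R X;
  th_nat : forall X Y (b : bispan X Y) (x : T X),
    th_fun (st_map b x) = st_map b (th_fun x)
}.

Section Underlying.
Variable gT : finGroupType.

Lemma bispan_of_span_iso (X Y : gset gT) (s t : span X Y) :
  span_iso s t -> bispan_iso (bispan_of_span s) (bispan_of_span t).
Proof. by case=> f [bf fl fr]; exists f, f; split. Qed.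

Section Comp.
Variables (X Y Z : gset gT) (s : span X Y) (t : span Y Z).
Let b := bispan_of_span s.
Let c := bispan_of_span t.

Definition sec_of (u : spS (span_comp s t)) : {ffun spS t -> option (spS s)} :=
  [ffun a => if a == (val u).2 then Some (val u).1 else None].

Fact sec_ofP u : @comp_secP gT X Y Z b c ((val u).2, sec_of u).
Proof.
apply/forallP=> a; rewrite /= ffunE.
rewrite -[sval u]/(val u); case: (eqVneq a (val u).2) => /= [->|_] //.
by rewrite (eqP (valP u)).
Qed.
Definition secB (u : spS (span_comp s t)) : comp_B b c :=
  exist _ ((val u).2, sec_of u) (sec_ofP u).
Fact secWP u : @comp_WP gT X Y Z b c (secB u, (val u).2).
Proof. by apply/eqP. Qed.
Definition secW (u : spS (span_comp s t)) : comp_W b c :=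
  exist _ (secB u, (val u).2) (secWP u).
Fact secAP u : @comp_AP gT X Y Z b c (secW u, (val u).1).
Proof. by rewrite /comp_AP /= ffunE eqxx. Qed.
Definition secA (u : spS (span_comp s t)) : comp_A b c :=
  exist _ (secW u, (val u).1) (secAP u).

Fact secBJ u g : secB (gact _ u g) = gact _ (secB u) g.
Proof.
apply: val_inj; congr pair; apply/ffunP=> a; rewrite !ffunE /=.
have -> : (gact _ a g^-1%g == (val u).2) = (a == gact _ (val u).2 g).
  apply/eqP/eqP=> [<-|->]; first by rewrite -actM mulVg act1.
  by rewrite -actM mulgV act1.
by case: eqP.
Qed.
Fact secAJ u g : secA (gact _ u g) = gact _ (secA u) g.
Proof.
apply: val_inj; congr pair; apply: val_inj; congr pair; exact: secBJ.
Qed.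

Lemma bispan_of_span_comp :
  bispan_iso (bispan_of_span (span_comp s t)) (bispan_comp b c).
Proof.
have injB : injective secB.
  move=> u v E; have E1 : (val u).2 = (val v).2 := congr1 (fun w => (val w).1) E.
  have Es : sec_of u = sec_of v := congr1 (fun w => (val w).2) E.
  move/ffunP/(_ (val u).2): Es; rewrite !ffunE -E1 eqxx => -[E2].
  by apply: val_inj; apply/eqP; rewrite -pair_eqE /pair_eq E1 E2 !eqxx.
have surjB v : exists u, secB u = v.
  case: v => -[a' f] Hf; move/forallP/(_ a'): (Hf); rewrite /= eqxx.
  case Ea: (f a') => [a|] //= /eqP [E].
  have Hu : @span_pbP gT X Y Z s t (a, a') by apply/eqP.
  exists (exist _ (a, a') Hu); apply: val_inj; congr pair.
  apply/ffunP=> x; rewrite ffunE /=; case: (eqVneq x a') => [->//|ne].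
  by move/forallP/(_ x): Hf; rewrite /= (negbTE ne); case: (f x).
have surjA v : exists u, secA u = v.
  case: v => -[[[w a'] Hw] a] Hv; have [u Eu] := surjB w; exists u.
  subst w; have E : (val u).2 = a' := eqP Hw.
  have : sec_of u a' == Some a by exact: Hv.
  rewrite ffunE -{1}E eqxx => /eqP [Ea].
  apply: val_inj; congr pair => //; apply: val_inj; congr pair => //.
have bij (A B : finType) (h : A -> B) :
    injective h -> (forall v, exists u, h u = v) -> bijective h.
  move=> ih sh; have [k hk] : exists k, cancel k h.
    have sh' v : exists u, h u == v by have [u <-] := sh v; exists u.
    by exists (fun v => xchoose (sh' v)) => v; apply/eqP/(xchooseP (sh' v)).
  by exists k => // x; apply: ih; rewrite hk.
exists (@GMap gT (spS (span_comp s t)) (comp_A b c) secA secAJ).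
exists (@GMap gT (spS (span_comp s t)) (comp_B b c) secB secBJ).
split=> /=; last by split.
  apply: bij => // u v E; apply: injB.
  exact: (congr1 (fun z : comp_A b c => (val (val z).1).1) E).
exact: bij.
Qed.
End Comp.

(* Restriction of T along the inclusion of spans into bispans. *)
Definition semi_mackey_of (T : semi_tambara gT) : semi_mackey gT :=
  @SemiMackey gT T (fun X Y s => st_map (bispan_of_span s))
    (fun X Y s t st => st_iso (bispan_of_span_iso st))
    (@st_id gT T)
    (fun X Y Z s t x =>
       etrans (st_iso (bispan_of_span_comp s t) x) (st_comp _ _ x))
    (st_pt T) (@st_ptP gT T) (@st_pair gT T)
    (@st_pairl gT T) (@st_pairr gT T) (@st_pairK gT T).

Definition mackey_of (T : tambara gT) : mackey gT :=
  @Mackey gT (semi_mackey_of T) (@tambara_opp gT T).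

End Underlying.

(* B, with its maps from T and R, is T [x] R: its underlying Mackey functor   *)
(* is the Day convolution of those of T and R, and its Tambara structure is   *)
(* the canonical one, namely the one for which t |-> t (x) 1 and              *)
(* r |-> 1 (x) r are maps of Tambara functors and t (x) r is the product of   *)
(* (the pullbacks to X * Y of) t (x) 1 and 1 (x) r.                           *)
Definition is_box_product gT (T R B : tambara gT)
    (iT : tambara_hom T B) (iR : tambara_hom R B) : Prop :=
  @is_day_convolution gT (mackey_of T) (mackey_of R) (mackey_of B)
    (fun X Y t r => st_mul (st_map (bres (gfst X Y)) (iT X t))
                           (st_map (bres (gsnd X Y)) (iR Y r))).

Inductive subring_gen gT (T : tambara gT) (X : gset gT) (I : Type) (s : I -> T X) :
    T X -> Prop :=
| sg_gen i : subring_gen s (s i)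
| sg_zero : subring_gen s (st_zero T X)
| sg_one : subring_gen s (st_one T X)
| sg_add x y : subring_gen s x -> subring_gen s y -> subring_gen s (st_add x y)
| sg_opp x y : subring_gen s x -> st_add x y = st_zero T X -> subring_gen s y
| sg_mul x y : subring_gen s x -> subring_gen s y -> subring_gen s (st_mul x y).

Definition fg_Zalgebra gT (T : tambara gT) (X : gset gT) : Prop :=
  exists n (s : 'I_n -> T X), forall x, subring_gen s x.

Definition levelwise_fg (gT : finGroupType) (T : tambara gT) : Prop :=
  forall H : {group gT}, fg_Zalgebra T (gorbit H).

(* Main.v *)
From HB Require Import structures.
From mathcomp Require Import all_boot all_fingroup ssralg ring.
From mathcomp Require Import boolp.
Require Import Defs.

Set Implicit Arguments.
Unset Strict Implicit.
Unset Printing Implicit Defensive.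

Import GRing.Theory.

(** Every element of the box product at [Y] has the form
[Tr f (iT a * iR b)] for a map of [G]-sets [f : X -> Y], with [a] in [T X] and
[b] in [R X]: elements of this form make up a sub-Mackey functor through which
the universal pairing factors, and the uniqueness half of the universal
property of the Day convolution then forces it to be everything
([day_convolution_ind], [box_generated]).  Cutting [X] into orbits, the group
at [Y = G/H] is generated by such transfers along the finitely many maps
[f : G/K -> G/H].

The key point is that restriction makes [T(G/K)] a finite module over
[T(G/H)].  Indeed, every [x] in [T X] is integral over the image of [T Y]
under [Res f], for any [f : X -> Y]: formally, [x] is a root of the norm of
[t - x].  To avoid polynomial extensions of Tambara functors, the coefficients
of that norm are constructed directly: the [i]-th one is the elementary
symmetric function [elem_sym f i (- x)], which sums, over the [i]-element
subsets of the fibres of [f], the norm (the product, twisted by the action) of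
the values of [- x].  Its
restriction along [f] is the symmetric function of the projection
[X *_Y X -> X], which has the diagonal as a section; separating the subsets
that contain the diagonal point from the others makes the evaluation at [x]
telescope to [0] ([elem_sym_base_change], [elem_sym_section],
[Res_integral]).  Since [T(G/K)] is a finitely generated ring, integrality
gives finiteness as a module ([finite_of_integral], [Res_finite]).

Now write [a] as a sum of [Res f alpha_i * a_i] and [b] as a sum of
[Res f beta_j * b_j], where the [a_i] and [b_j] range over finite lists that
depend on [f] only.  Frobenius reciprocity turns [Tr f (iT a * iR b)] into the
sum of [iT alpha_i * iR beta_j * Tr f (iT a_i * iR b_j)].  Hence the ring at
[G/H] is generated by the images of the generators of [T(G/H)] and [R(G/H)]
and the finitely many elements [Tr f (iT a_i * iR b_j)] ([Tr_finite]).

The calculus behind this (functoriality and base change for restrictions,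
norms and transfers, Frobenius reciprocity, the ring laws) is derived from the
composition of bispans through one recognition criterion,
[bispan_comp_iso]. *)

(** * Maps of finite G-sets *)

Lemma inj_surj_bij (A B : finType) (h : A -> B) :
  injective h -> (forall v, exists u, h u = v) -> bijective h.
Proof.
move=> ih sh; have sh' v : exists u, h u == v by have [u <-] := sh v; exists u.
have hk : cancel (fun v => xchoose (sh' v)) h.
  by move=> v; apply/eqP/(xchooseP (sh' v)).
by exists (fun v => xchoose (sh' v)) => // x; apply: ih; rewrite hk.
Qed.

Section GMaps.
Variable gT : finGroupType.
Implicit Types X Y Z : gset gT.

Definition gpair Z X Y (f : gmap Z X) (g : gmap Z Y) : gmap Z (gprod X Y).
Proof. by exists (fun z => (f z, g z)) => z a; rewrite !gmapP. Defined.

Definition glift Z X (P : pred X) (PJ : forall x g, P x -> P (gact X x g))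
  (f : gmap Z X) (fP : forall z, P (f z)) : gmap Z (gsub PJ).
Proof.
exists (fun z => exist _ (f z) (fP z)) => z a.
by apply: val_inj; rewrite /= gmapP.
Defined.

Definition gcopair X Y Z (f : gmap X Z) (g : gmap Y Z) : gmap (gsum X Y) Z.
Proof.
exists (fun u : X + Y => match u with inl x => f x | inr y => g y end).
by case=> x a /=; rewrite gmapP.
Defined.

Definition gsum_map X X' Y Y' (f : gmap X X') (g : gmap Y Y') :
  gmap (gsum X Y) (gsum X' Y') :=
  gcopair (gmap_comp (ginl X' Y') f) (gmap_comp (ginr X' Y') g).

Definition is_coprod A B X (i : gmap A X) (j : gmap B X) :=
  bijective (gcopair i j).

Definition is_pb X Y Z P (f : gmap X Z) (g : gmap Y Z)
    (p : gmap P X) (q : gmap P Y) : Prop :=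
  [/\ forall w, f (p w) = g (q w),
      forall x y, f x = g y -> exists w, p w = x /\ q w = y &
      forall w w', p w = p w' -> q w = q w' -> w = w'].

Lemma ginv X Y (f : gmap X Y) : bijective f ->
  exists2 h : gmap Y X, cancel f h & cancel h f.
Proof.
case=> h fK hK; have hJ y g : h (gact Y y g) = gact X (h y) g.
  by rewrite -{1}[y]hK -gmapP fK.
by exists (GMap hJ).
Qed.

Lemma is_coprod_sum X Y : is_coprod (ginl X Y) (ginr X Y).
Proof. by exists id => -[]. Qed.

Lemma is_pb_refl X Y (f : gmap X Y) :
  injective f -> is_pb f f (gmap_id X) (gmap_id X).
Proof. by move=> fI; split=> // x y /fI <-; exists x. Qed.

Lemma is_pb_id X Y (f : gmap X Y) : is_pb f (gmap_id Y) (gmap_id X) f.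
Proof. by split=> // x y /= <-; exists x. Qed.

Lemma is_pb_sym X Y Z P (f : gmap X Z) (g : gmap Y Z)
    (p : gmap P X) (q : gmap P Y) : is_pb f g p q -> is_pb g f q p.
Proof.
case=> H1 H2 H3; split=> [w|x y E|w w' E1 E2]; first by rewrite H1.
  by have [w [? ?]] := H2 y x (esym E); exists w.
exact: H3.
Qed.

Lemma is_pb_sum_inl X X' Y Y' (f : gmap X X') (g : gmap Y Y') :
  is_pb (gsum_map f g) (ginl X' Y') (ginl X Y) f.
Proof. by split=> // [[x|y] y' //= [<-]|x y [->]] //; exists x. Qed.

Lemma is_pb_sum_inr X X' Y Y' (f : gmap X X') (g : gmap Y Y') :
  is_pb (gsum_map f g) (ginr X' Y') (ginr X Y) g.
Proof. by split=> // [[x|y] y' //= [<-]|x y [->]] //; exists y. Qed.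

Lemma is_pb_fold X Y (g : gmap Y X) :
  is_pb (gfold X) g (gsum_map g g) (gfold Y).
Proof.
split=> [[]|[x|x] y /= ->|[x|x] [y|y]] //= => [||_ <-|_ <-] //.
  by exists (inl y).
by exists (inr y).
Qed.

Lemma ex_pb X Y Z (f : gmap X Z) (g : gmap Y Z) :
  exists W (p : gmap W X) (q : gmap W Y), is_pb f g p q.
Proof.
pose s := span_comp (str f) (sres g).
exists (spS s), (gmap_comp (gmap_id X) (spl s)), (gmap_comp (gmap_id Y) (spr s)).
split=> [u|x y /eqP E|u v E1 E2]; first exact/eqP/(valP u).
  by exists (exist (fun u : gprod X Y => f u.1 == g u.2) (x, y) E).
exact/val_inj/injective_projections.
Qed.
End GMaps.

(** * Recognizing a composite of bispans *)

(** Up to isomorphism, a point of the middle set of a composite is a point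
[beta u] of the middle set of [c] together with a section over its fibre; the
section is recorded by the partial function [ev u], defined on the fibre only.
A point of the left-hand set adds a point [wC a] of that fibre and a lift
[wA a] of the value of the section there.  So [d] is the composite as soon as
such data exist and are parametrized bijectively by [d]. *)
Section Criterion.
Variables (gT : finGroupType) (X Y Z : gset gT).
Variables (b : bispan X Y) (c : bispan Y Z) (d : bispan X Z).
Variables (beta : gmap (bsB d) (bsB c)) (ev : bsB d -> bsA c -> option (bsB b)).
Variables (wA : gmap (bsA d) (bsA b)) (wC : gmap (bsA d) (bsA c)).
Hypothesis ev_sec : forall u a,
  omap (bsr b) (ev u a) = if bsq c a == beta u then Some (bsp c a) else None.
Hypothesis evJ : forall (u : bsB d) (a : bsA c) g,
  ev (gact _ u g) (gact _ a g) = omap (fun y => gact _ y g) (ev u a).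
Hypothesis ev_inj : forall u v,
  beta u = beta v -> (forall a, ev u a = ev v a) -> u = v.
Hypothesis ev_surj : forall y s, @comp_secP _ _ _ _ b c (y, s) ->
  exists u, beta u = y /\ forall a, ev u a = s a.
Hypothesis wC_q : forall a, bsq c (wC a) = beta (bsq d a).
Hypothesis wA_q : forall a, ev (bsq d a) (wC a) = Some (bsq b (wA a)).
Hypothesis w_inj : forall a a',
  bsq d a = bsq d a' -> wC a = wC a' -> wA a = wA a' -> a = a'.
Hypothesis w_surj : forall u ac ab,
  bsq c ac = beta u -> ev u ac = Some (bsq b ab) ->
  exists a, [/\ bsq d a = u, wC a = ac & wA a = ab].
Hypothesis wA_p : forall a, bsp b (wA a) = bsp d a.
Hypothesis beta_r : forall u, bsr c (beta u) = bsr d u.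

Let sec u : gpfun (bsA c) (bsB b) := [ffun a => ev u a].

Fact criterion_B : exists gam : gmap (bsB d) (comp_B b c),
  forall u, val (gam u) = (beta u, sec u).
Proof.
have secP u : @comp_secP _ _ _ _ b c (beta u, sec u).
  by apply/forallP => a; rewrite ffunE ev_sec.
have secJ (u : bsB d) g : sec (gact _ u g) = gact _ (sec u) g.
  by apply/ffunP => a; rewrite !ffunE -{1}[a](actKV (gact _) g) evJ.
by exists (@glift gT (bsB d) _ _ (@comp_secJ _ _ _ _ b c)
             (gpair beta (GMap secJ)) secP).
Qed.

Section CriterionA.
Variable gam : gmap (bsB d) (comp_B b c).
Hypothesis gamE : forall u, val (gam u) = (beta u, sec u).

Fact criterion_B_bij : bijective gam.
Proof.
apply: inj_surj_bij => [u v E|v].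
  have := congr1 val E; rewrite !gamE => -[E1 /ffunP E2].
  by apply: ev_inj => // a; have := E2 a; rewrite !ffunE.
have := valP v; case E : (val v) => [y s] Hs.
have [u [Ey Es]] := ev_surj Hs; exists u.
apply: val_inj; rewrite E gamE Ey; congr pair.
by apply/ffunP => a; rewrite ffunE.
Qed.

Fact criterion_W : exists alpW : gmap (bsA d) (comp_W b c),
  forall a, val (alpW a) = (gam (bsq d a), wC a).
Proof.
have gamW a : @comp_WP _ _ _ _ b c (gam (bsq d a), wC a).
  by rewrite /comp_WP gamE wC_q.
by exists (@glift gT (bsA d) _ _ (@comp_WJ _ _ _ _ b c)
             (gpair (gmap_comp gam (bsq d)) wC) gamW).
Qed.

Section CriterionW.
Variable alpW : gmap (bsA d) (comp_W b c).
Hypothesis alpWE : forall a, val (alpW a) = (gam (bsq d a), wC a).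

Fact criterion_A : exists alp : gmap (bsA d) (comp_A b c),
  forall a, val (alp a) = (alpW a, wA a).
Proof.
have alpP a : @comp_AP _ _ _ _ b c (alpW a, wA a).
  by rewrite /comp_AP alpWE gamE ffunE wA_q.
by exists (@glift gT (bsA d) _ _ (@comp_AJ _ _ _ _ b c) (gpair alpW wA) alpP).
Qed.

Fact criterion_A_bij (alp : gmap (bsA d) (comp_A b c)) :
  (forall a, val (alp a) = (alpW a, wA a)) -> bijective alp.
Proof.
move=> alpE; have [gam' _ gamK] := criterion_B_bij.
apply: inj_surj_bij => [a a' E|v].
  have := congr1 val E; rewrite !alpE => -[/(congr1 val) EW EA].
  move: EW; rewrite !alpWE => -[/(bij_inj criterion_B_bij) Eq EC].
  exact: w_inj.
case Ev : (val v) (valP v) => [w ab]; case Ew : (val w) (valP w) => [y ac].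
have Ey : val y = (beta (gam' y), sec (gam' y)) by rewrite -gamE gamK.
rewrite /comp_WP /comp_AP [val (w, ab).1]Ew [val (y, ac).1]Ey /= ffunE.
move=> /eqP /esym Hy /eqP Hev.
have [a [Eq EC EA]] := w_surj Hy Hev.
exists a; apply: val_inj; rewrite alpE Ev EA; congr pair.
by apply: val_inj; rewrite alpWE Ew Eq EC gamK.
Qed.
End CriterionW.
End CriterionA.

Lemma bispan_comp_iso : bispan_iso d (bispan_comp b c).
Proof.
have [gam gamE] := criterion_B.
have [alpW alpWE] := criterion_W gamE.
have [alp alpE] := criterion_A gamE alpWE.
exists alp, gam; split.
- exact: criterion_A_bij alpE.
- exact: criterion_B_bij.
split=> [a|a|u].
- by rewrite -wA_p -[RHS]/(bsp b (alpW a, wA a).2) -alpE.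
- rewrite -[RHS]/((gam (bsq d a), wC a).1) -alpWE.
  by rewrite -[in RHS]/((alpW a, wA a).1) -alpE.
- by rewrite -beta_r -[RHS]/(bsr c (beta u, sec u).1) -gamE.
Qed.

End Criterion.

(** The composite with a span [Y <- C -> Z] is a pair of pullbacks, because
the fibres of the identity are points. *)
Lemma comp_span_iso (gT : finGroupType) (X Y Z A B C A' B' : gset gT)
    (p : gmap A X) (q : gmap A B) (r : gmap B Y) (l : gmap C Y) (m : gmap C Z)
    (u : gmap B' B) (v : gmap B' C) (w : gmap A' A) (q' : gmap A' B') :
  is_pb r l u v -> is_pb q u w q' ->
  bispan_iso (Bispan (gmap_comp p w) q' (gmap_comp m v))
    (bispan_comp (Bispan p q r) (Bispan l (gmap_id C) m)).
Proof.
move=> [ruv uv_ex uv_inj] [qwq wq_ex wq_inj].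
pose ev (x : B') (c : C) : option B := if c == v x then Some (u x) else None.
set b := Bispan p q r; set c := Bispan l _ m; set d := Bispan _ _ _.
apply: (@bispan_comp_iso gT X Y Z b c d v ev w (gmap_comp v q'));
  rewrite /= ?/ev //=.
- by move=> x a; case: eqP => //= ->; rewrite ruv.
- move=> x a g; rewrite gmapP (inj_eq (act_inj (gact C) g)).
  by case: eqP => //= _; rewrite gmapP.
- by move=> x y E /(_ (v x)); rewrite E eqxx => -[E']; apply: uv_inj.
- move=> y s /forallP Hs; have := Hs y; rewrite /= eqxx.
  case Es: (s y) => [t|] //= /eqP [Eb]; have [x [Ex Ey]] := uv_ex _ _ Eb.
  exists x; split=> // a; have := Hs a; rewrite /= Ey Ex.
  by case: (eqVneq a y) => [->|_]; [rewrite Es | case: (s a)].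
- by move=> a; rewrite eqxx qwq.
- by move=> a a' E _ E'; apply: wq_inj.
- move=> x a1 a -> ; rewrite eqxx => -[] /esym Ea.
  by have [y [<- <-]] := wq_ex _ _ Ea; exists y.
Qed.

(** If the right leg of the first bispan is an identity, the sections in the
composite are determined by the second bispan. *)
Lemma comp_rid_iso (gT : finGroupType) (X Y Z A A' B' W : gset gT)
    (p : gmap A X) (q : gmap A Y)
    (p' : gmap A' Y) (q' : gmap A' B') (r' : gmap B' Z)
    (w : gmap W A) (z : gmap W A') :
  is_pb q p' w z ->
  bispan_iso (Bispan (gmap_comp p w) (gmap_comp q' z) r')
    (bispan_comp (Bispan p q (gmap_id Y)) (Bispan p' q' r')).
Proof.
move=> [qwp wz_ex wz_inj].
pose ev (x : B') (a : A') : option Y := if q' a == x then Some (p' a) else None.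
set b := Bispan p q _; set c := Bispan p' q' r'; set d := Bispan _ _ _.
apply: (@bispan_comp_iso gT X Y Z b c d (gmap_id B') ev w z);
  rewrite /= ?/ev //=.
- by move=> x a; case: eqP.
- move=> x a g; rewrite gmapP (inj_eq (act_inj (gact B') g)).
  by case: eqP => //= _; rewrite gmapP.
- move=> y s /forallP Hs; exists y; split=> // a; have /eqP := Hs a => /=.
  by case: eqP => _; case: (s a) => [t|] //= [<-].
- by move=> a; rewrite eqxx qwp.
- by move=> a a' _ E' E; apply: wz_inj.
- move=> x a1 a <-; rewrite eqxx => -[] /esym Ea.
  by have [y [<- <-]] := wz_ex _ _ Ea; exists y.
Qed.

(** Distributivity of multiplication over a transfer in the first factor: a
section of [f + id : X + Y -> Y + Y] over the fibre [{inl y, inr y}] of the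
fold map amounts to a point of [X] above [y], as the second value is forced. *)
Lemma comp_frobenius_iso (gT : finGroupType) (X Y : gset gT) (f : gmap X Y) :
  bispan_iso (Bispan (gsum_map (gmap_id X) f) (gfold X) f)
    (bispan_comp (btr (gsum_map f (gmap_id Y))) (bnorm (gfold Y))).
Proof.
pose ev (x : X) (a : gsum Y Y) : option (gsum X Y) :=
  match a with
  | inl y => if y == f x then Some (inl x) else None
  | inr y => if y == f x then Some (inr y) else None
  end.
set b := btr _; set c := bnorm _; set d := Bispan _ _ _.
apply: (@bispan_comp_iso gT _ _ _ b c d f ev
         (gsum_map (gmap_id X) f) (gsum_map f f)); rewrite /= ?/ev //=.
- by move=> x [y|y]; case: eqP => //= ->.
- move=> x [y|y] g; rewrite gmapP /= (inj_eq (act_inj (gact Y) g));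
  by case: eqP.
- by move=> x x' E /(_ (inl (f x))); rewrite E eqxx => -[].
- move=> y s /forallP Hs; have := Hs (inl y); rewrite /= eqxx.
  case Es: (s (inl y)) => [[x|x]|] //= /eqP [] // Ex; exists x; split=> // a.
  have := Hs a; rewrite /= Ex.
  case: a => y'; case: (eqVneq y' y) => [->|_].
  + by rewrite Es.
  + by case: (s _).
  + by case: (s _) => [[x'|x']|] //= /eqP [] // ->.
  + by case: (s _).
- by case.
- by case=> x; rewrite eqxx.
- by case=> x [x'|x'] //= ->.
- move=> x [y|y] [x'|x'] ->; rewrite eqxx //= => -[] // <-.
    by exists (inl x).
  by exists (inr x).
Qed.

(** * Restriction, norm and transfer *)

Section Calculus.
Variables (gT : finGroupType) (T : semi_tambara gT).
Implicit Types X Y Z : gset gT.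

Definition Res X Y (f : gmap X Y) : T Y -> T X := st_map (bres f).
Definition Nm X Y (f : gmap X Y) : T X -> T Y := st_map (bnorm f).
Definition Tr X Y (f : gmap X Y) : T X -> T Y := st_map (btr f).

Lemma bispan_ext X Y A B (p p' : gmap A X) (q q' : gmap A B) (r r' : gmap B Y) :
  p =1 p' -> q =1 q' -> r =1 r' ->
  st_map (Bispan p q r) =1 st_map (Bispan p' q' r') :> (T X -> T Y).
Proof.
move=> Ep Eq Er; apply: st_iso; exists (gmap_id A), (gmap_id B).
split; [by exists id | by exists id | split=> x /=].
- exact/esym/Ep.
- exact/esym/Eq.
- exact/esym/Er.
Qed.

Lemma Res_ext X Y (f g : gmap X Y) : f =1 g -> Res f =1 Res g.
Proof. by move=> E; apply: bispan_ext. Qed.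
Lemma Nm_ext X Y (f g : gmap X Y) : f =1 g -> Nm f =1 Nm g.
Proof. by move=> E; apply: bispan_ext. Qed.
Lemma Tr_ext X Y (f g : gmap X Y) : f =1 g -> Tr f =1 Tr g.
Proof. by move=> E; apply: bispan_ext. Qed.

Lemma Res_id X : Res (gmap_id X) =1 id. Proof. exact: st_id. Qed.
Lemma Nm_id X : Nm (gmap_id X) =1 id. Proof. exact: st_id. Qed.
Lemma Tr_id X : Tr (gmap_id X) =1 id. Proof. exact: st_id. Qed.

Lemma Res_comp X Y Z (f : gmap X Y) (g : gmap Y Z) x :
  Res (gmap_comp g f) x = Res f (Res g x).
Proof.
rewrite /Res -st_comp; symmetry.
rewrite -(st_iso (comp_rid_iso _ _ _ (is_pb_sym (is_pb_id f)))).
exact: bispan_ext.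
Qed.

Lemma Nm_comp X Y Z (f : gmap X Y) (g : gmap Y Z) x :
  Nm (gmap_comp g f) x = Nm g (Nm f x).
Proof.
rewrite /Nm -st_comp -(st_iso (comp_rid_iso _ _ _ (is_pb_id f))).
exact: bispan_ext.
Qed.

Lemma bispanE X Y A B (p : gmap A X) (q : gmap A B) (r : gmap B Y) x :
  st_map (Bispan p q r) x = Tr r (Nm q (Res p x)).
Proof.
have -> : Nm q (Res p x) = st_map (Bispan p q (gmap_id B)) x.
  rewrite /Nm /Res -st_comp; symmetry.
  have pb := is_pb_id (gmap_id A).
  etransitivity; last exact: (st_iso (comp_rid_iso p q (gmap_id B) pb)).
  exact: bispan_ext.
rewrite /Tr -st_comp.
have pb := is_pb_id (gmap_id B).
etransitivity; last exact: (st_iso (comp_span_iso p r pb (is_pb_id q))).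
exact: bispan_ext.
Qed.

Lemma Tr_comp X Y Z (f : gmap X Y) (g : gmap Y Z) x :
  Tr (gmap_comp g f) x = Tr g (Tr f x).
Proof.
rewrite /Tr -st_comp.
have pb := is_pb_id (gmap_id X).
etransitivity; last first.
  exact: (st_iso (comp_span_iso (gmap_id X) g (is_pb_id f) pb)).
exact: bispan_ext.
Qed.

Lemma Res_Tr X Y Z P (f : gmap X Z) (g : gmap Y Z)
    (p : gmap P X) (q : gmap P Y) x :
  is_pb f g p q -> Res g (Tr f x) = Tr q (Res p x).
Proof.
move=> pb; rewrite /Res /Tr -st_comp.
have -> : st_map (btr q) (st_map (bres p) x) =
          st_map (Bispan p (gmap_id P) q) x.
  by rewrite bispanE Nm_id.
rewrite -(st_iso (comp_span_iso _ _ pb (is_pb_sym (is_pb_id p)))).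
exact: bispan_ext.
Qed.

Lemma Res_Nm X Y Z P (f : gmap X Z) (g : gmap Y Z)
    (p : gmap P X) (q : gmap P Y) x :
  is_pb f g p q -> Res g (Nm f x) = Nm q (Res p x).
Proof.
move=> pb; rewrite /Res /Nm -st_comp.
have -> : st_map (bnorm q) (st_map (bres p) x) =
          st_map (Bispan p q (gmap_id Y)) x.
  by rewrite bispanE Tr_id.
rewrite -(st_iso (comp_span_iso _ _ (is_pb_sym (is_pb_id g)) pb)).
exact: bispan_ext.
Qed.

Lemma Nm_fold_Tr X Y (f : gmap X Y) z :
  Nm (gfold Y) (Tr (gsum_map f (gmap_id Y)) z) =
  Tr f (Nm (gfold X) (Res (gsum_map (gmap_id X) f) z)).
Proof. by rewrite -bispanE (st_iso (comp_frobenius_iso f)) st_comp. Qed.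

Lemma pair_ext X Y (z z' : T (gsum X Y)) :
  Res (ginl X Y) z = Res (ginl X Y) z' ->
  Res (ginr X Y) z = Res (ginr X Y) z' ->
  z = z'.
Proof.
by rewrite /Res => E1 E2; rewrite -[z]st_pairK -[z']st_pairK E1 E2.
Qed.

Lemma Res_inl X Y (x : T X) (y : T Y) : Res (ginl X Y) (st_pair x y) = x.
Proof. exact: st_pairl. Qed.
Lemma Res_inr X Y (x : T X) (y : T Y) : Res (ginr X Y) (st_pair x y) = y.
Proof. exact: st_pairr. Qed.

Lemma Res_copair X Y Z (f : gmap X Z) (g : gmap Y Z) z :
  Res (gcopair f g) z = st_pair (Res f z) (Res g z).
Proof.
by apply: pair_ext; rewrite ?Res_inl ?Res_inr -Res_comp; apply: Res_ext.
Qed.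

Lemma Res_sum_map X X' Y Y' (f : gmap X X') (g : gmap Y Y') x y :
  Res (gsum_map f g) (st_pair x y) = st_pair (Res f x) (Res g y).
Proof. by rewrite Res_copair !Res_comp Res_inl Res_inr. Qed.

(** Transfers and norms share the properties below, and these suffice to turn
pushing forward along the fold map into a commutative monoid law preserved by
restriction: addition and multiplication are the two instances. *)
Record pushforward (F : forall X Y, gmap X Y -> T X -> T Y) : Prop := {
  pf_ext : forall X Y (f g : gmap X Y), f =1 g -> F X Y f =1 F X Y g;
  pf_id : forall X, F X X (gmap_id X) =1 id;
  pf_comp : forall X Y Z (f : gmap X Y) (g : gmap Y Z) x,
    F X Z (gmap_comp g f) x = F Y Z g (F X Y f x);
  pf_base_change : forall X Y Z P (f : gmap X Z) (g : gmap Y Z)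
      (p : gmap P X) (q : gmap P Y) x,
    is_pb f g p q -> Res g (F X Z f x) = F P Y q (Res p x)
}.

Lemma Tr_pushforward : pushforward Tr.
Proof.
by split; [exact: Tr_ext | exact: Tr_id | exact: Tr_comp | exact: Res_Tr].
Qed.

Lemma Nm_pushforward : pushforward Nm.
Proof.
by split; [exact: Nm_ext | exact: Nm_id | exact: Nm_comp | exact: Res_Nm].
Qed.

Section Fold.
Variable F : forall X Y, gmap X Y -> T X -> T Y.
Hypothesis pF : pushforward F.

Let F_ext X Y (f g : gmap X Y) : f =1 g -> F f =1 F g := @pf_ext F pF X Y f g.
Let F_id X : F (gmap_id X) =1 id := @pf_id F pF X.
Let F_comp X Y Z (f : gmap X Y) (g : gmap Y Z) x :
  F (gmap_comp g f) x = F g (F f x) := @pf_comp F pF X Y Z f g x.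
Let Res_F X Y Z P (f : gmap X Z) (g : gmap Y Z)
    (p : gmap P X) (q : gmap P Y) x :
    is_pb f g p q -> Res g (F f x) = F q (Res p x) :=
  @pf_base_change F pF X Y Z P f g p q x.

Let op X (x y : T X) := F (gfold X) (st_pair x y).
Let unit X : T X := F (gempty_map X) (st_pt T).

Lemma fold_pair X X' Y Y' (f : gmap X X') (g : gmap Y Y') x y :
  F (gsum_map f g) (st_pair x y) = st_pair (F f x) (F g y).
Proof.
apply: pair_ext; rewrite ?Res_inl ?Res_inr.
  by rewrite (Res_F _ (is_pb_sum_inl f g)) Res_inl.
by rewrite (Res_F _ (is_pb_sum_inr f g)) Res_inr.
Qed.

Lemma fold_bij X Y (k : gmap X Y) z : bijective k -> F k (Res k z) = z.
Proof.
move=> /ginv [h kK hK]; have RI : injective (Res k).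
  apply: (@can_inj _ _ _ (Res h)) => y; rewrite -Res_comp -[RHS]Res_id.
  exact: Res_ext.
by apply: RI; rewrite (Res_F _ (is_pb_refl (can_inj kK))) F_id Res_id.
Qed.

Lemma fold_empty X Y (f : gmap X Y) z : (X -> False) -> F f z = unit Y.
Proof.
move=> X0; have kB : bijective (gempty_map X).
  by apply: inj_surj_bij => [[]|x]; case: (X0 x).
rewrite -(fold_bij z kB) -F_comp (st_ptP (Res _ _)).
by apply: F_ext => -[].
Qed.

Lemma fold_split A B X Y (i : gmap A X) (j : gmap B X) (f : gmap X Y) z :
  is_coprod i j ->
  F f z = op (F (gmap_comp f i) (Res i z)) (F (gmap_comp f j) (Res j z)).
Proof.
move=> ij.
rewrite -{1}(fold_bij z ij) Res_copair -F_comp /op -fold_pair -F_comp.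
by apply: F_ext => -[].
Qed.

Lemma fold_opC X : commutative (@op X).
Proof.
move=> x y; rewrite {1}/op.
have cp : is_coprod (ginr X X) (ginl X X).
  exists (fun u : X + X => match u with inl a => inr a | inr a => inl a end).
    by case.
  by case.
rewrite (fold_split _ _ cp) Res_inl Res_inr.
by rewrite !(@F_ext _ _ _ (gmap_id X)) // !F_id.
Qed.

(** Both sides push [pair x (pair y w)] forward along the map
[X + (X + X) -> X], the triple coproduct being cut in two different ways. *)
Lemma fold_opA X : associative (@op X).
Proof.
move=> x y w; set f := gcopair (gmap_id X) (gfold X).
have cp1 := is_coprod_sum X (gsum X X).
pose i := gcopair (ginl X (gsum X X)) (gmap_comp (ginr X _) (ginl X X)).
pose j := gmap_comp (ginr X (gsum X X)) (ginr X X).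
have cp2 : is_coprod i j.
  exists (fun u : X + (X + X) => match u with
            | inl a => inl (inl a)
            | inr (inl a) => inl (inr a)
            | inr (inr a) => inr a end).
    by case=> [[]|].
  by case=> [|[]].
have := fold_split f (st_pair x (st_pair y w)) cp1.
rewrite (fold_split _ _ cp2) Res_copair !Res_comp !Res_inl !Res_inr Res_inl => E.
have idE (g : gmap X X) (z : T X) : g =1 id -> z = F g z.
  by move=> gid; rewrite -[LHS]F_id; apply: F_ext => u; rewrite gid.
transitivity (op (F (gmap_comp f i) (st_pair x y)) (F (gmap_comp f j) w)).
  by rewrite E; congr (op _ _); [apply: idE | apply: F_ext => -[]].
by congr (op _ _); [apply: F_ext => -[] | apply/esym/idE].
Qed.

Lemma fold_op1 X : left_id (unit X) (@op X).
Proof.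
move=> x; have cp : is_coprod (gempty_map X) (gmap_id X).
  by exists (fun x => inr x) => [[]|].
rewrite -[RHS]F_id (fold_split _ _ cp) Res_id !F_comp !F_id.
by rewrite (st_ptP (Res _ _)).
Qed.

Lemma Res_op X Y (g : gmap Y X) x y : Res g (op x y) = op (Res g x) (Res g y).
Proof. by rewrite /op (Res_F _ (is_pb_fold g)) Res_sum_map. Qed.

Lemma Res_unit X Y (g : gmap Y X) : Res g (unit X) = unit Y.
Proof.
have pb : is_pb (gempty_map X) g (gmap_id _) (gempty_map Y) by split=> -[].
by rewrite /unit (Res_F _ pb) Res_id.
Qed.

Lemma F_op X Y (f : gmap X Y) x y : F f (op x y) = op (F f x) (F f y).
Proof.
by rewrite /op -fold_pair -!F_comp; apply: F_ext => -[].
Qed.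

End Fold.
End Calculus.

(** * The ring structure on the values of a Tambara functor *)

Local Open Scope ring_scope.

Section Semiring.
Variables (gT : finGroupType) (T : semi_tambara gT).
Implicit Types X Y : gset gT.

Lemma st_addA X : associative (@st_add gT T X).
Proof. exact: (fold_opA (@Tr_pushforward gT T)). Qed.
Lemma st_addC X : commutative (@st_add gT T X).
Proof. exact: (fold_opC (@Tr_pushforward gT T)). Qed.
Lemma st_add0 X : left_id (st_zero T X) (@st_add gT T X).
Proof. exact: (fold_op1 (@Tr_pushforward gT T)). Qed.
Lemma st_mulA X : associative (@st_mul gT T X).
Proof. exact: (fold_opA (@Nm_pushforward gT T)). Qed.
Lemma st_mulC X : commutative (@st_mul gT T X).
Proof. exact: (fold_opC (@Nm_pushforward gT T)). Qed.
Lemma st_mul1 X : left_id (st_one T X) (@st_mul gT T X).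
Proof. exact: (fold_op1 (@Nm_pushforward gT T)). Qed.

Lemma Tr_pair X X' Y Y' (f : gmap X X') (g : gmap Y Y') (x : T X) (y : T Y) :
  Tr (gsum_map f g) (st_pair x y) = st_pair (Tr f x) (Tr g y).
Proof. exact: (fold_pair (@Tr_pushforward gT T)). Qed.

(** Frobenius reciprocity; distributivity is the case of a fold map. *)
Lemma st_frobenius X Y (f : gmap X Y) (x : T X) (y : T Y) :
  st_mul (Tr f x) y = Tr f (st_mul x (Res f y)).
Proof.
rewrite {1}/st_mul -[y in st_pair _ y]Tr_id -Tr_pair.
by rewrite -/(Nm _ _) Nm_fold_Tr Res_sum_map Res_id.
Qed.

Lemma st_mulDl X : left_distributive (@st_mul gT T X) (@st_add gT T X).
Proof.
move=> x y z; rewrite /st_add -/(Tr _ _) st_frobenius; congr Tr.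
apply: pair_ext;
  rewrite (Res_op (@Nm_pushforward gT T)) ?Res_inl ?Res_inr -Res_comp.
  by rewrite (@Res_ext _ _ _ _ _ (gmap_id X)) // Res_id.
by rewrite (@Res_ext _ _ _ _ _ (gmap_id X)) // Res_id.
Qed.

Lemma Res_mul X Y (f : gmap X Y) (x y : T Y) :
  Res f (st_mul x y) = st_mul (Res f x) (Res f y).
Proof. exact: (Res_op (@Nm_pushforward gT T)). Qed.
Lemma Res_add X Y (f : gmap X Y) (x y : T Y) :
  Res f (st_add x y) = st_add (Res f x) (Res f y).
Proof. exact: (Res_op (@Tr_pushforward gT T)). Qed.
Lemma Res_one X Y (f : gmap X Y) : Res f (st_one T Y) = st_one T X.
Proof. exact: (Res_unit (@Nm_pushforward gT T)). Qed.
End Semiring.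

Section Ring.
Variables (gT : finGroupType) (T : tambara gT) (X : gset gT).

HB.instance Definition _ := gen_eqMixin (T X).
HB.instance Definition _ := gen_choiceMixin (T X).

Definition t_opp (x : T X) : T X := projT1 (cid (tambara_opp x)).
Fact t_addN : left_inverse (st_zero T X) t_opp (@st_add gT T X).
Proof. by move=> x; rewrite st_addC /t_opp; case: cid. Qed.

HB.instance Definition _ := GRing.isZmodule.Build (T X)
  (@st_addA gT T X) (@st_addC gT T X) (@st_add0 gT T X) t_addN.
HB.instance Definition _ := GRing.Zmodule_isComPzRing.Build (T X)
  (@st_mulA gT T X) (@st_mulC gT T X) (@st_mul1 gT T X) (@st_mulDl gT T X).
End Ring.

Section RingMaps.
Variables (gT : finGroupType) (T : tambara gT).
Implicit Types X Y : gset gT.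

Lemma ResD X Y (f : gmap X Y) : {morph @Res gT T X Y f : x y / x + y}.
Proof. exact: Res_add. Qed.
Lemma ResM X Y (f : gmap X Y) : {morph @Res gT T X Y f : x y / x * y}.
Proof. exact: Res_mul. Qed.
Lemma Res1 X Y (f : gmap X Y) : @Res gT T X Y f 1 = 1.
Proof. exact: Res_one. Qed.
Lemma Res0 X Y (f : gmap X Y) : @Res gT T X Y f 0 = 0.
Proof. by apply: (addrI (Res f 0)); rewrite -ResD !addr0. Qed.
Lemma TrD X Y (f : gmap X Y) : {morph @Tr gT T X Y f : x y / x + y}.
Proof. exact: (F_op (@Tr_pushforward gT T)). Qed.
Lemma Tr_Res X Y (f : gmap X Y) (x : T X) (y : T Y) :
  Tr f (x * Res f y) = Tr f x * y.
Proof. by rewrite -st_frobenius. Qed.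
Lemma ResN X Y (f : gmap X Y) (x : T Y) : Res f (- x) = - Res f x.
Proof. by apply: (addrI (Res f x)); rewrite -ResD !subrr Res0. Qed.
Lemma Tr0 X Y (f : gmap X Y) : @Tr gT T X Y f 0 = 0.
Proof. by apply: (addrI (Tr f 0)); rewrite -TrD !addr0. Qed.

Lemma Tr_empty X Y (f : gmap X Y) (x : T X) : (X -> False) -> Tr f x = 0.
Proof. exact: (fold_empty (@Tr_pushforward gT T)). Qed.
Lemma Nm_empty X Y (f : gmap X Y) (x : T X) : (X -> False) -> Nm f x = 1.
Proof. exact: (fold_empty (@Nm_pushforward gT T)). Qed.
Lemma Tr_split A B X Y (i : gmap A X) (j : gmap B X) (f : gmap X Y) (z : T X) :
  is_coprod i j ->
  Tr f z = Tr (gmap_comp f i) (Res i z) + Tr (gmap_comp f j) (Res j z).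
Proof. exact: (fold_split (@Tr_pushforward gT T)). Qed.
Lemma Nm_split A B X Y (i : gmap A X) (j : gmap B X) (f : gmap X Y) (z : T X) :
  is_coprod i j ->
  Nm f z = Nm (gmap_comp f i) (Res i z) * Nm (gmap_comp f j) (Res j z).
Proof. exact: (fold_split (@Nm_pushforward gT T)). Qed.
End RingMaps.

(** * Elementary symmetric functions of a finite covering *)

Section Subsets.
Variable gT : finGroupType.
Implicit Types V W X : gset gT.

Definition gpow W : gset gT := @GSet gT {set W} (gact W)^*%act.

Definition gimset W X (f : gmap W X) : gmap (gpow W) (gpow X).
Proof.
exists (fun S : {set W} => f @: S) => S g /=.
by rewrite /setact -!imset_comp; apply: eq_imset => a /=; rewrite gmapP.
Defined.

(** [fsub] is the set of [i]-element subsets of the fibres of [q], as a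
[G]-set over [V]; the base point [fsub_base] is kept because the empty subset
does not determine it.  [fpt] is the tautological covering of [fsub], whose
fibre over a subset is that subset. *)
Section Fibre.
Variables (V W : gset gT) (q : gmap W V) (i : nat).

Definition fsubP (u : gprod V (gpow W)) : bool :=
  (#|(u.2 : {set W})| == i) && [forall (a | a \in u.2), q a == u.1].
Fact fsubJ u g : fsubP u -> fsubP (gact _ u g).
Proof.
case/andP=> cu /forall_inP qu; apply/andP; split.
  by rewrite card_imset //; apply: act_inj.
by apply/forall_inP => _ /imsetP [a /qu /eqP qa ->]; rewrite gmapP qa.
Qed.
Definition fsub : gset gT := gsub fsubJ.
Definition fsub_base : gmap fsub V := gmap_comp (gfst _ _) (gsub_val fsubJ).
Definition fsub_set : gmap fsub (gpow W) :=
  gmap_comp (gsnd _ _) (gsub_val fsubJ).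

Definition fptP (u : gprod fsub W) : bool := u.2 \in fsub_set u.1.
Fact fptJ u g : fptP u -> fptP (gact _ u g).
Proof. by move=> ua; rewrite /fptP gmapP; apply/imsetP; exists u.2. Qed.
Definition fpt : gset gT := gsub fptJ.
Definition fpt_sub : gmap fpt fsub := gmap_comp (gfst _ _) (gsub_val fptJ).
Definition fpt_pt : gmap fpt W := gmap_comp (gsnd _ _) (gsub_val fptJ).

Lemma fsub_inj (u v : fsub) :
  fsub_base u = fsub_base v -> fsub_set u = fsub_set v -> u = v.
Proof. by move=> E1 E2; apply/val_inj/injective_projections. Qed.
Lemma fsub_card (u : fsub) : #|(fsub_set u : {set W})| = i.
Proof. by case/andP: (valP u) => /eqP. Qed.
Lemma fsub_q (u : fsub) a : a \in fsub_set u -> q a = fsub_base u.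
Proof. by case/andP: (valP u) => _ /forall_inP H /H /eqP. Qed.

Lemma fsub_ex v (S : {set W}) : #|S| = i -> (forall a, a \in S -> q a = v) ->
  exists u : fsub, fsub_base u = v /\ fsub_set u = S.
Proof.
move=> cS qS; have H : fsubP (v, S).
  by rewrite /fsubP /= cS eqxx; apply/forall_inP => a /qS /eqP.
by exists (exist _ (v, S) H).
Qed.

Lemma fpt_inj (u v : fpt) :
  fpt_sub u = fpt_sub v -> fpt_pt u = fpt_pt v -> u = v.
Proof. by move=> E1 E2; apply/val_inj/injective_projections. Qed.
Lemma fpt_in (u : fpt) : fpt_pt u \in fsub_set (fpt_sub u).
Proof. exact: (valP u). Qed.
Lemma fpt_ex (u : fsub) a : a \in fsub_set u ->
  exists p : fpt, fpt_sub p = u /\ fpt_pt p = a.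
Proof.
by move=> ua; have H : fptP (u, a) by []; exists (exist _ (u, a) H).
Qed.

Section Lift.
Variables (Z : gset gT) (f : gmap Z V) (s : gmap Z (gpow W)).
Hypothesis s_card : forall z, #|(s z : {set W})| = i.
Hypothesis s_q : forall z a, a \in s z -> q a = f z.
Lemma fsub_lift : exists h : gmap Z fsub,
  (forall z, fsub_base (h z) = f z) /\ forall z, fsub_set (h z) = s z.
Proof.
have H z : fsubP (gpair f s z).
  rewrite /fsubP /= s_card eqxx /=; apply/forall_inP => a az.
  exact/eqP/s_q.
by exists (@glift gT Z _ _ fsubJ (gpair f s) H).
Qed.
End Lift.

Lemma fpt_lift Z (h : gmap Z fsub) (k : gmap Z W) :
  (forall z, k z \in fsub_set (h z)) ->
  exists l : gmap Z fpt, (forall z, fpt_sub (l z) = h z) /\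
                         forall z, fpt_pt (l z) = k z.
Proof.
move=> H; have H' z : fptP (gpair h k z) by apply: H.
by exists (@glift gT Z _ _ fptJ (gpair h k) H').
Qed.

End Fibre.
End Subsets.
(* From here on these maps are handled through the lemmas above; making them
   opaque keeps simplification from exposing the subtypes. *)
Opaque fsub_base fsub_set fpt_sub fpt_pt.

Section ElementarySymmetric.
Variables (gT : finGroupType) (T : tambara gT).
Implicit Types V W X Y : gset gT.

(** The sum, over the [i]-element subsets of the fibres of [q], of the product
of the values of [w], both twisted by the action of the group.  For a trivial
covering [n V -> V] it is the classical [i]-th elementary symmetric polynomial
in [n] variables. *)
Definition elem_sym V W (q : gmap W V) (i : nat) (w : T W) : T V :=
  Tr (fsub_base q i) (Nm (fpt_sub q i) (Res (fpt_pt q i) w)).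

(** In a pullback square the fibres of [q'] are carried bijectively to those
of [q], hence so are their subsets, and the two coverings defining [elem_sym]
are pulled back along [g] as well. *)
Lemma elem_sym_base_change V W V' W' (q : gmap W V) (g : gmap V' V)
    (g' : gmap W' W) (q' : gmap W' V') i (w : T W) :
  is_pb q g g' q' -> Res g (elem_sym q i w) = elem_sym q' i (Res g' w).
Proof.
move=> [com ex inj].
have inj' (u : fsub q' i) : {in fsub_set _ _ u &, injective g'}.
  by move=> a b /fsub_q Ea /fsub_q Eb E; apply: inj; rewrite // Ea Eb.
have [gB [gB1 gB2]] : exists h : gmap (fsub q' i) (fsub q i),
    (forall z, fsub_base q i (h z) = g (fsub_base q' i z)) /\
    forall z, fsub_set q i (h z) = (g' @: (fsub_set q' i z : {set W'}))%SET.
  apply: (fsub_lift (f := gmap_comp g (fsub_base q' i))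
            (s := gmap_comp (gimset g') (fsub_set q' i))) => [z|z a /=].
    by rewrite /= card_in_imset ?fsub_card //; apply: inj'.
  by case/imsetP=> b /fsub_q Eb ->; rewrite com Eb.
have [gA [gA1 gA2]] : exists l : gmap (fpt q' i) (fpt q i),
    (forall z, fpt_sub q i (l z) = gB (fpt_sub q' i z)) /\
    forall z, fpt_pt q i (l z) = g' (fpt_pt q' i z).
  apply: (fpt_lift (h := gmap_comp gB (fpt_sub q' i))
            (k := gmap_comp g' (fpt_pt q' i))) => z.
  by rewrite /= gB2; apply: imset_f; apply: fpt_in.
have pbB : is_pb (fsub_base q i) g gB (fsub_base q' i).
  split=> [u|u v E|u v E1 E2]; first exact: gB1.
    pose S : {set W'} := [set a | (q' a == v) && (g' a \in fsub_set q i u)].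
    have gS : g' @: S = fsub_set q i u :> {set W}.
      apply/setP=> b; apply/imsetP/idP=> [[a]|bu].
        by rewrite inE => /andP [_ ?] ->.
      have [a [Ea Ea']] := ex b v (etrans (fsub_q bu) E).
      by exists a; rewrite ?inE ?Ea ?Ea' ?eqxx.
    have [||s [Es1 Es2]] := @fsub_ex _ _ _ q' i v S.
    - rewrite -(fsub_card u) -gS card_in_imset // => a b.
      rewrite !inE => /andP [/eqP Ea _] /andP [/eqP Eb _] ?.
      by apply: inj; rewrite ?Ea ?Eb.
    - by move=> a; rewrite inE => /andP [/eqP].
    exists s; split=> //; apply: fsub_inj; first by rewrite gB1 Es1.
    by rewrite gB2 -gS Es2.
  apply: fsub_inj => //.
  have : g' @: (fsub_set q' i u : {set W'}) = g' @: (fsub_set q' i v : {set W'}).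
    by rewrite -!gB2 E1.
  move/setP=> ES; apply/setP=> a; apply/idP/idP=> Ha.
    have := ES (g' a); rewrite imset_f // => /esym /imsetP [b Hb Eb].
    by rewrite (inj a b) // (fsub_q Ha) (fsub_q Hb).
  have := ES (g' a); rewrite [RHS]imset_f // => /imsetP [b Hb Eb].
  by rewrite (inj a b) // (fsub_q Ha) (fsub_q Hb).
have pbA : is_pb (fpt_sub q i) gB gA (fpt_sub q' i).
  split=> [u|u v E|u v E1 E2]; first exact: gA1.
    have := fpt_in u; rewrite E gB2 => /imsetP [a av Ea].
    have [p [Ep1 Ep2]] := fpt_ex av; exists p; split=> //.
    by apply: fpt_inj; rewrite ?gA1 ?gA2 ?Ep1 ?Ep2.
  apply: fpt_inj => //; apply: (inj' (fpt_sub q' i u)); first exact: fpt_in.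
    by rewrite E2; apply: fpt_in.
  by rewrite -!gA2 E1.
rewrite /elem_sym (Res_Tr _ pbB) (Res_Nm _ pbA) -!Res_comp.
by congr (Tr _ (Nm _ _)); apply: Res_ext => u /=; rewrite gA2.
Qed.

Lemma elem_sym0 V W (q : gmap W V) (w : T W) : elem_sym q 0 w = 1.
Proof.
rewrite /elem_sym Nm_empty => [|u]; last first.
  have /cards0_eq u0 := fsub_card (fpt_sub q 0 u).
  by have := fpt_in u; rewrite u0 inE.
rewrite -(Res1 T (fsub_base q 0)).
apply: (fold_bij (@Tr_pushforward gT T)).
apply: inj_surj_bij => [u v E|v].
  apply: fsub_inj => //.
  by rewrite (cards0_eq (fsub_card u)) (cards0_eq (fsub_card v)).
have [|a|s [Es _]] := @fsub_ex _ _ _ q 0 v set0; last by exists s.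
  exact: cards0.
by rewrite inE.
Qed.

Lemma elem_sym_large V W (q : gmap W V) i (w : T W) :
  (#|W| < i)%N -> elem_sym q i w = 0.
Proof.
move=> lt_i; apply: Tr_empty => u; have := max_card (fsub_set q i u : {set W}).
by rewrite fsub_card leqNgt lt_i.
Qed.

(** The analogue of [e_(i+1)(x_0, ..., x_n) = e_(i+1)(x_1, ..., x_n) + x_0 *
e_i(x_1, ..., x_n)]: a subset of a fibre either avoids the point of the
section or consists of that point and a subset of the rest. *)
Lemma elem_sym_section V W (q : gmap W V) i (w : T (gsum V W)) :
  elem_sym (gcopair (gmap_id V) q) i.+1 w =
  elem_sym q i.+1 (Res (ginr V W) w) +
  Res (ginl V W) w * elem_sym q i (Res (ginr V W) w).
Proof.
set Q := gcopair _ _.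
have cardR (S : {set W}) : #|[set (inr a : V + W) | a in S]| = #|S|.
  by apply: card_imset => a b [].
have inrP (S : {set W}) a : ((inr a : V + W) \in [set inr b | b in S]) = (a \in S).
  by apply: mem_imset => b c [].
have inlP (S : {set W}) v : ((inl v : V + W) \in [set inr b | b in S]) = false.
  by apply/imsetP => -[].
(* [h] and [k] embed the subsets avoiding, resp. containing, the section. *)
have [h [h1 h2]] : exists h : gmap (fsub q i.+1) (fsub Q i.+1),
    (forall z, fsub_base Q i.+1 (h z) = fsub_base q i.+1 z) /\
    forall z, fsub_set Q i.+1 (h z) = [set inr a | a in (fsub_set q i.+1 z : {set W})].
  apply: (fsub_lift (f := fsub_base q i.+1)
           (s := gmap_comp (gimset (ginr V W)) (fsub_set q i.+1))) => [z|z a /=].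
    by rewrite /= cardR fsub_card.
  by case/imsetP=> b /fsub_q Eb ->.
pose s0 (z : fsub q i) : gpow (gsum V W) :=
  ((inl (fsub_base q i z) : V + W) |: [set inr a | a in (fsub_set q i z : {set W})]).
have s0J z g : s0 (gact _ z g) = gact _ (s0 z) g.
  rewrite /s0 !gmapP /= /setact imsetU1 -!imset_comp.
  by congr (_ |: _).
have [k [k1 k2]] : exists h : gmap (fsub q i) (fsub Q i.+1),
    (forall z, fsub_base Q i.+1 (h z) = fsub_base q i z) /\
    forall z, fsub_set Q i.+1 (h z) = s0 z.
  apply: (fsub_lift (f := fsub_base q i) (s := GMap s0J)) => [z|z a /=].
    by rewrite /= /s0 cardsU1 inlP cardR fsub_card.
  by case/setU1P => [-> //|/imsetP [b /fsub_q Eb ->]].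
(* For surjectivity, a subset [u] of a fibre of [Q] over [v] comes from the set
   [S] of its points outside the section, according to whether it contains
   [inl v]. *)
have cop : is_coprod h k.
  apply: inj_surj_bij => [[u|u] [v|v] /= E|u].
  - congr inl; apply: fsub_inj; first by rewrite -!h1 E.
    by apply/setP=> a; rewrite -inrP -h2 E h2 inrP.
  - have := h2 u; rewrite E k2 => /setP /(_ (inl (fsub_base q i v))).
    by rewrite inlP setU11.
  - have := h2 v; rewrite -E k2 => /setP /(_ (inl (fsub_base q i u))).
    by rewrite inlP setU11.
  - congr inr; apply: fsub_inj; first by rewrite -!k1 E.
    apply/setP=> a; have := k2 u; rewrite E k2 => /setP /(_ (inr a)).
    by rewrite !inE /= !inrP.
  set v := fsub_base Q i.+1 u.
  pose S : {set W} := [set a | inr a \in fsub_set Q i.+1 u].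
  have Sq a : a \in S -> q a = v by rewrite inE => /fsub_q.
  have ES (b : V + W) : b \in fsub_set Q i.+1 u ->
      b = inl v \/ b \in [set inr a | a in S].
    case: b => [v'|a] Hb; first by left; have := fsub_q Hb => /= ->.
    by right; rewrite inrP inE.
  have := boolP (inl v \in fsub_set Q i.+1 u); case=> Hv.
    have Eu : fsub_set Q i.+1 u = inl v |: [set inr a | a in S] :> {set V + W}.
      apply/setP=> b; rewrite in_setU1; apply/idP/orP=> [/ES [->|]|[/eqP ->|]] //.
      - by left.
      - by right.
      - by case/imsetP=> a; rewrite inE => ? ->.
    have [|s [Es1 Es2]] := fsub_ex (i := i) _ Sq.
      by apply/succn_inj; rewrite -(fsub_card u) Eu cardsU1 inlP cardR.
    exists (inr s); apply: fsub_inj; first by rewrite /= k1 Es1.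
    by rewrite /= k2 Eu /s0 Es1 Es2.
  have Eu : fsub_set Q i.+1 u = [set inr a | a in S] :> {set V + W}.
    apply/setP=> b; apply/idP/idP=> [Hb|/imsetP [a]].
      by case: (ES b Hb) => // Eb; rewrite -Eb Hb in Hv.
    by rewrite inE => ? ->.
  have [|s [Es1 Es2]] := fsub_ex (i := i.+1) _ Sq.
    by rewrite -(fsub_card u) Eu cardR.
  exists (inl s); apply: fsub_inj; first by rewrite /= h1 Es1.
  by rewrite /= h2 Eu Es2.
(* Over the image of [k] the tautological covering splits off the point of the
   section, which contributes the factor [Res (ginl V W) w]. *)
have [hA [hA1 hA2]] : exists l : gmap (fpt q i.+1) (fpt Q i.+1),
    (forall z, fpt_sub Q i.+1 (l z) = h (fpt_sub q i.+1 z)) /\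
    forall z, fpt_pt Q i.+1 (l z) = inr (fpt_pt q i.+1 z).
  apply: (fpt_lift (h := gmap_comp h (fpt_sub q i.+1))
            (k := gmap_comp (ginr V W) (fpt_pt q i.+1))) => z.
  by rewrite /= h2 inrP; apply: fpt_in.
have [kA [kA1 kA2]] : exists l : gmap (gsum (fsub q i) (fpt q i)) (fpt Q i.+1),
    (forall z, fpt_sub Q i.+1 (l z) = k (gcopair (gmap_id _) (fpt_sub q i) z)) /\
    forall z, fpt_pt Q i.+1 (l z) = gsum_map (fsub_base q i) (fpt_pt q i) z.
  apply: (fpt_lift (h := gmap_comp k (gcopair (gmap_id _) (fpt_sub q i)))
            (k := gsum_map (fsub_base q i) (fpt_pt q i))) => -[z|z].
    by rewrite /= k2 setU11.
  by rewrite /= k2 in_setU1 inrP fpt_in orbT.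
have pbh : is_pb (fpt_sub Q i.+1) h hA (fpt_sub q i.+1).
  split=> [u|u v E|u v E1 E2]; first exact: hA1.
    have := fpt_in u; rewrite E h2 => /imsetP [a av Ea].
    have [p [Ep1 Ep2]] := fpt_ex av; exists p; split=> //.
    by apply: fpt_inj; rewrite ?hA1 ?hA2 ?Ep1 ?Ep2.
  by apply: fpt_inj => //; have := hA2 u; rewrite E1 hA2 => -[].
have pbk : is_pb (fpt_sub Q i.+1) k kA (gcopair (gmap_id _) (fpt_sub q i)).
  split=> [u|u v E|u v E1 E2]; first exact: kA1.
    have := fpt_in u; rewrite E k2 => /setU1P [Ea|/imsetP [a av Ea]].
      by exists (inl v); split=> //; apply: fpt_inj; rewrite ?kA1 ?kA2.
    have [p [Ep1 Ep2]] := fpt_ex av; exists (inr p); split=> //.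
    by apply: fpt_inj; rewrite ?kA1 ?kA2 /= ?Ep1 ?Ep2.
  have := kA2 u; rewrite E1 kA2; case: u v {E1} E2 => u [v|v] //= E2.
    by rewrite E2.
  by case=> E3; congr inr; apply: fpt_inj.
rewrite /elem_sym (Tr_split _ _ cop) (Res_Nm _ pbh) (Res_Nm _ pbk).
rewrite (Nm_split _ _ (is_coprod_sum (fsub q i) (fpt q i))) -!Res_comp.
rewrite (@Tr_ext _ _ _ _ _ (fsub_base q i.+1)); last exact: h1.
rewrite (@Tr_ext _ _ _ _ _ (fsub_base q i)); last exact: k1.
congr (_ + _).
  by congr (Tr _ (Nm _ _)); apply: Res_ext => u /=; rewrite hA2.
rewrite (@Nm_ext _ _ _ _ _ (gmap_id _)) // Nm_id.
rewrite [RHS]mulrC -Tr_Res [in RHS]mulrC -Res_comp; congr (Tr _ (_ * _)).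
  by apply: Res_ext => u /=; rewrite kA2.
rewrite (@Nm_ext _ _ _ _ _ (fpt_sub q i)) //; congr Nm.
by apply: Res_ext => u /=; rewrite kA2.
Qed.

End ElementarySymmetric.

(** * Restriction maps are integral *)

Section Integrality.
Variables (gT : finGroupType) (T : tambara gT) (X Y : gset gT) (f : gmap X Y).

Definition offdiagP (u : gprod X X) : bool := (u.1 != u.2) && (f u.1 == f u.2).
Fact offdiagJ u g : offdiagP u -> offdiagP (gact _ u g).
Proof.
case/andP=> ne /eqP E; apply/andP; split; last by rewrite /= !gmapP E.
by rewrite (inj_eq (act_inj (gact X) g)).
Qed.
Definition offdiag : gset gT := gsub offdiagJ.
Definition offdiag1 : gmap offdiag X :=
  gmap_comp (gfst _ _) (gsub_val offdiagJ).
Definition offdiag2 : gmap offdiag X :=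
  gmap_comp (gsnd _ _) (gsub_val offdiagJ).

(** The fibre product [X *_Y X] is the disjoint union of the diagonal and its
complement [offdiag]. *)
Lemma is_pb_offdiag :
  is_pb f f (gcopair (gmap_id X) offdiag2) (gcopair (gmap_id X) offdiag1).
Proof.
split=> [[x|u]|x y E|[x|u] [y|v]] //=.
- by case/andP: (valP u) => _ /eqP.
- case: (eqVneq y x) => [->|ne]; first by exists (inl x).
  have H : offdiagP (y, x) by rewrite /offdiagP /= ne E eqxx.
  by exists (inr (exist _ (y, x) H)).
- by move->.
- by move=> Ex Ey; case/andP: (valP v); rewrite /= -Ex -Ey eqxx.
- by move=> Ex Ey; case/andP: (valP u); rewrite /= Ex Ey eqxx.
- by move=> E2 E1; congr inr; apply/val_inj/injective_projections.
Qed.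

(** Writing [c i] for the coefficients [elem_sym f i (- x)] and [e i] for the
symmetric functions of the off-diagonal part, [elem_sym_section] reads
[Res f (c i.+1) = e i.+1 - x * e i].  Horner evaluation of
[sum_i Res f (c i) * x ^ (n - i)] therefore telescopes to [e n], which is [0]
for [n] larger than every fibre. *)
Lemma Res_integral (x : T X) : exists n (c : nat -> T Y),
  x ^+ n = \sum_(i < n) Res f (c i) * x ^+ i.
Proof.
pose e i := elem_sym offdiag1 i (Res offdiag2 (- x)).
pose c i := elem_sym f i (- x).
have c0 : Res f (c 0) = 1 by rewrite /c elem_sym0 Res1.
have cS i : Res f (c i.+1) = e i.+1 - x * e i.
  rewrite /c (elem_sym_base_change _ _ is_pb_offdiag) elem_sym_section Res_copair.
  by rewrite Res_inl Res_inr Res_id mulNr.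
have eE n : exists d : nat -> T Y,
    e n = x ^+ n + \sum_(i < n) Res f (d i) * x ^+ i.
  elim: n => [|n [d IH]].
    by exists (fun=> 0); rewrite big_ord0 addr0 /e elem_sym0.
  exists (fun i => if i is j.+1 then d j else c n.+1).
  rewrite big_ord_recl expr0 mulr1 cS.
  have -> : \sum_(i < n) Res f (d i) * x ^+ bump 0 i =
            x * \sum_(i < n) Res f (d i) * x ^+ i.
    by rewrite mulr_sumr; apply: eq_bigr => i _; rewrite exprS mulrCA.
  by rewrite IH exprS; ring.
have [d Ed] := eE #|offdiag|.+1.
exists #|offdiag|.+1, (fun i => - d i).
move/eqP: Ed; rewrite /e elem_sym_large // eq_sym addr_eq0 => /eqP ->.
by rewrite -sumrN; apply: eq_bigr => i _; rewrite ResN mulNr.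
Qed.

End Integrality.

(** * Finite modules over a subring *)

Section FiniteModules.
Variables (C : comPzRingType) (S : C -> Prop).
Hypothesis S1 : S 1.
Hypothesis SN : forall a, S a -> S (- a).
Hypothesis SM : forall a b, S a -> S b -> S (a * b).

Inductive lin_span (l : seq C) : C -> Prop :=
| span0 : lin_span l 0
| span_cons a y x : S a -> y \in l -> lin_span l x -> lin_span l (a * y + x).

Lemma spanD l x y : lin_span l x -> lin_span l y -> lin_span l (x + y).
Proof.
elim=> [|a z t Sa zl _ IH] ly; rewrite ?add0r // -addrA.
by constructor; auto.
Qed.

Lemma spanZ l a x : S a -> lin_span l x -> lin_span l (a * x).
Proof.
move=> Sa; elim=> [|b y z Sb yl _ IH]; first by rewrite mulr0; constructor.
by rewrite mulrDr mulrA; constructor; auto.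
Qed.

Lemma span_mem l y : y \in l -> lin_span l y.
Proof. by move=> yl; rewrite -[y]mul1r -[1 * y]addr0; do !constructor. Qed.

Lemma spanN l x : lin_span l x -> lin_span l (- x).
Proof. by move=> lx; rewrite -mulN1r; apply: spanZ; auto. Qed.

Lemma span_sum l n (F : 'I_n -> C) :
  (forall i, lin_span l (F i)) -> lin_span l (\sum_(i < n) F i).
Proof. by move=> lF; elim/big_ind: _ => //; [constructor | exact: spanD]. Qed.

Lemma span_mul l1 l2 l x y :
  (forall a b, a \in l1 -> b \in l2 -> lin_span l (a * b)) ->
  lin_span l1 x -> lin_span l2 y -> lin_span l (x * y).
Proof.
move=> H lx ly; elim: lx => [|a s z Sa sl _ IH].
  by rewrite mul0r; constructor.
rewrite mulrDl; apply: spanD => //; rewrite -mulrA; apply: spanZ => //.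
elim: ly {IH} => [|b t u Sb tl _ IH]; first by rewrite mulr0; constructor.
by rewrite mulrDr; apply: spanD => //; rewrite mulrCA; apply: spanZ; auto.
Qed.

(** These are the conditions under which the span of [l] is a subring. *)
Definition span_closed l :=
  lin_span l 1 /\ forall x y, x \in l -> y \in l -> lin_span l (x * y).

Lemma span_closed_allpairs l1 l2 : span_closed l1 -> span_closed l2 ->
  let l := [seq x * y | x <- l1, y <- l2] in
  [/\ span_closed l, forall x, lin_span l1 x -> lin_span l x &
      forall x, lin_span l2 x -> lin_span l x].
Proof.
move=> [one1 mul1] [one2 mul2] l.
have lM x y : lin_span l1 x -> lin_span l2 y -> lin_span l (x * y).
  by apply: span_mul => a b al bl; apply/span_mem/allpairs_f.
split=> [|x lx|x lx]; last 2 first.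
- by rewrite -[x]mulr1; apply: lM.
- by rewrite -[x]mul1r; apply: lM.
split=> [|_ _ /allpairsP [[a b] [/= al bl ->]] /allpairsP [[c d] [/= cl dl ->]]].
  by rewrite -[1]mulr1; apply: lM.
by rewrite mulrACA; apply: lM; auto.
Qed.

Lemma span_closed_powers x n (c : nat -> C) : (forall i, S (c i)) ->
  x ^+ n = \sum_(i < n) c i * x ^+ i ->
  exists l, span_closed l /\ lin_span l x.
Proof.
move=> Sc xn; pose l := [seq x ^+ i | i <- iota 0 n].
have pow_l i : (i < n)%N -> lin_span l (x ^+ i).
  by move=> lt_in; apply/span_mem/map_f; rewrite mem_iota.
have l_n : lin_span l (x ^+ n).
  by rewrite xn; apply: span_sum => i; apply: spanZ; auto.
have l_x y : lin_span l y -> lin_span l (x * y).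
  elim=> [|a z t Sa]; first by rewrite mulr0; constructor.
  case/mapP=> i; rewrite mem_iota add0n => /= lt_in -> _ IH.
  rewrite mulrDr; apply: spanD => //; rewrite mulrCA -exprS; apply: spanZ => //.
  by move: lt_in; rewrite leq_eqVlt => /predU1P [->|/pow_l].
have l1 : lin_span l 1.
  case: (posnP n) => [n0|/pow_l]; last by rewrite expr0.
  by move: l_n; rewrite [in x ^+ n]n0 expr0.
have l_pow k : lin_span l (x ^+ k).
  by elim: k => [|k IH]; rewrite ?expr0 // exprS; apply: l_x.
exists l; split; last by rewrite -[x]expr1.
split=> // _ _ /mapP [i _ ->] /mapP [j _ ->].
by rewrite -exprD.
Qed.

(** The products of small powers of finitely many integral elements span a
subring containing them. *)
Lemma finite_of_integral (s : seq C) :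
  (forall x, x \in s -> exists n (c : nat -> C),
     (forall i, S (c i)) /\ x ^+ n = \sum_(i < n) c i * x ^+ i) ->
  exists l, span_closed l /\ forall x, x \in s -> lin_span l x.
Proof.
elim: s => [|x s IH] int_s.
  exists [:: 1]; split=> //; split; first by apply: span_mem; rewrite inE.
  move=> x y; rewrite !inE => /eqP -> /eqP ->; rewrite mulr1.
  by apply: span_mem; rewrite inE.
have [y ys|l1 [cl1 sl1]] := IH; first by apply: int_s; rewrite inE ys orbT.
have [n [c [Sc xn]]] := int_s x (mem_head x s).
have [l2 [cl2 xl2]] := span_closed_powers Sc xn.
have [cl l1l l2l] := span_closed_allpairs cl2 cl1.
eexists; split; first exact: cl.
by move=> y; rewrite inE => /predU1P [->|/sl1]; auto.
Qed.

End FiniteModules.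

(** * Elements of a box product *)

(** A family of predicates stable under the structure of a Mackey functor cuts
out a Mackey functor. *)
Section SubMackey.
Variables (gT : finGroupType) (M : mackey gT) (P : forall X, M X -> Prop).
Hypothesis P_map : forall X Y (s : span X Y) x, P x -> P (sm_map s x).
Hypothesis P_pt : P (sm_pt M).
Hypothesis P_pair : forall X Y (x : M X) (y : M Y),
  P x -> P y -> P (sm_pair x y).
Hypothesis P_opp : forall X (x y : M X), P x -> sm_add x y = sm_zero M X -> P y.

Let obj X := {x : M X | P x}.
Let objI X (u v : obj X) : sval u = sval v -> u = v.
Proof.
by case: u v => [x Px] [y Py] /= E; subst y; rewrite (Prop_irrelevance Px Py).
Qed.

Definition sub_semi_mackey : semi_mackey gT.
Proof.
apply: (@SemiMackey gT obj
  (fun X Y s u => exist _ (sm_map s (sval u)) (P_map s (svalP u))) _ _ _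
  (exist _ (sm_pt M) P_pt) _
  (fun X Y u v => exist _ (sm_pair (sval u) (sval v))
                    (P_pair (svalP u) (svalP v)))).
- by move=> X Y s t st u; apply: objI; apply: sm_iso.
- by move=> X u; apply: objI; apply: sm_id.
- by move=> X Y Z s t u; apply: objI; apply: sm_comp.
- by move=> u; apply: objI; apply: sm_ptP.
- by move=> X Y u v; apply: objI; apply: sm_pairl.
- by move=> X Y u v; apply: objI; apply: sm_pairr.
- by move=> X Y u; apply: objI; apply: sm_pairK.
Defined.

Definition sub_mackey : mackey gT.
Proof.
apply: (@Mackey gT sub_semi_mackey) => X u.
have [y Ey] := mackey_opp (sval u).
by exists (exist _ y (P_opp (svalP u) Ey)); apply: objI.
Defined.

End SubMackey.

(** The pairing factors through the sub-Mackey functor cut out by [P]; composed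
with the inclusion, the resulting endomorphism of [D] fixes the values of
[phi], so it is the identity by uniqueness, and [P] holds everywhere. *)
Lemma day_convolution_ind gT (M N D : mackey gT) (phi : pairing M N D)
    (P : forall X, D X -> Prop) :
  is_day_convolution phi ->
  (forall X Y (s : span X Y) x, P X x -> P Y (sm_map s x)) ->
  P _ (sm_pt D) ->
  (forall X Y (x : D X) (y : D Y), P X x -> P Y y -> P _ (sm_pair x y)) ->
  (forall X (x y : D X), P X x -> sm_add x y = sm_zero D X -> P X y) ->
  (forall X Y m n, P _ (phi X Y m n)) ->
  forall X x, P X x.
Proof.
move=> [nat_phi univ] P_map P_pt P_pair P_opp P_phi X x.
pose D' := sub_mackey P_map P_pt P_pair P_opp.
pose psi : pairing M N D' := fun X Y m n => exist _ (phi X Y m n) (P_phi X Y m n).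
have nat_psi : natural_pairing psi.
  move=> X1 X2 Y1 Y2 s t m n; have := nat_phi _ _ _ _ s t m n.
  rewrite /psi /=; move: (P_phi X2 Y2 _ _) => + E; rewrite E => p.
  by congr exist; apply: Prop_irrelevance.
have [h [h_phi _]] := univ D' psi nat_psi.
have [h0 [_ h0_uniq]] := univ D phi nat_phi.
pose ih : mackey_hom D D := @MackeyHom gT D D (fun X x => sval (h X x))
  (fun X Y s x => congr1 sval (mh_nat h s x)).
pose one : mackey_hom D D :=
  @MackeyHom gT D D (fun X x => x) (fun X Y s x => erefl).
have Eih : ih X x = h0 X x by apply: h0_uniq => X1 Y1 m n /=; rewrite h_phi.
have Eone : one X x = h0 X x by apply: h0_uniq.
rewrite -[x]/(one X x) Eone -Eih; exact: (svalP (h X x)).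
Qed.

Section TambaraHom.
Variables (gT : finGroupType) (T R : tambara gT) (h : tambara_hom T R).
Implicit Types X Y : gset gT.

Lemma hom_Res X Y (f : gmap X Y) x : h _ (Res f x) = Res f (h _ x).
Proof. exact: th_nat. Qed.
Lemma hom_pair X Y (x : T X) (y : T Y) :
  h _ (st_pair x y) = st_pair (h _ x) (h _ y).
Proof. by apply: pair_ext; rewrite -hom_Res ?Res_inl ?Res_inr. Qed.
Lemma homD X : {morph h X : x y / x + y}.
Proof.
by move=> x y; rewrite -[x + y]/(st_add x y) /st_add th_nat hom_pair.
Qed.
Lemma homM X : {morph h X : x y / x * y}.
Proof.
by move=> x y; rewrite -[x * y]/(st_mul x y) /st_mul th_nat hom_pair.
Qed.
Lemma hom0 X : h X 0 = 0.
Proof. by apply: (addrI (h X 0)); rewrite -homD !addr0. Qed.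
Lemma homN X (x : T X) : h X (- x) = - h X x.
Proof. by apply: (addrI (h X x)); rewrite -homD !subrr hom0. Qed.
Lemma hom1 X : h X 1 = 1.
Proof. by rewrite -[1]/(st_one T X) /st_one th_nat (st_ptP (h _ _)). Qed.
End TambaraHom.

Section Box.
Variables (gT : finGroupType) (T R B : tambara gT).
Variables (iT : tambara_hom T B) (iR : tambara_hom R B).

(** A sum of transfers is one transfer from a disjoint union, so the elements of
this form are already closed under pairing; closure under spans is base
change. *)
Lemma box_generated : is_box_product iT iR -> forall Y (z : B Y),
  exists X (f : gmap X Y) (a : T X) (b : R X), z = Tr f (iT X a * iR X b).
Proof.
move=> box; apply: (day_convolution_ind box).
- move=> X Y s _ [W [f [a [b ->]]]].
  have [V [p [q pb]]] := ex_pb f (spl s).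
  exists V, (gmap_comp (spr s) q), (Res p a), (Res p b).
  rewrite [LHS]bispanE (Res_Tr _ pb) Nm_id Tr_comp.
  by rewrite ResM !hom_Res.
- exists (gempty gT), (gmap_id _), (st_pt T), (st_pt R).
  by rewrite [RHS]st_ptP.
- move=> X Y _ _ [W [f [a [b ->]]]] [V [g [a' [b' ->]]]].
  exists (gsum W V), (gsum_map f g), (st_pair a a'), (st_pair b b').
  rewrite -[LHS]Tr_pair; congr Tr.
  by apply: pair_ext; rewrite !hom_pair ResM ?Res_inl ?Res_inr.
- move=> X _ y [W [f [a [b ->]]]] E.
  exists W, f, (- a), b; apply: (addrI (Tr f (iT W a * iR W b))).
  rewrite -TrD homN mulNr subrr -[LHS]/(sm_add (_ : mackey_of B X) y) E.
  by rewrite Tr0.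
move=> X Y t r.
exists (gprod X Y), (gmap_id _), (Res (gfst X Y) t), (Res (gsnd X Y) r).
by rewrite Tr_id !hom_Res.
Qed.
End Box.

(** * Decomposition into orbits *)

Section Orbits.
Variables (gT : finGroupType) (X : gset gT) (x0 : X).

Let K := 'C[x0 | gact X]%G.
(* The map from the cosets of the stabilizer onto the orbit; by [orbE] the
   chosen representative does not matter. *)
Let orb (C : gorbit K) : X := gact X x0 (repr (val C)).

Let orbE (C : gorbit K) g : val C = (K :* g)%g -> orb C = gact X x0 g.
Proof.
move=> E; rewrite /orb E; case: repr_rcosetP => k /astab1P kx.
by rewrite actM kx.
Qed.

Let orbJ (C : gorbit K) g : orb (gact _ C g) = gact X (orb C) g.
Proof.
case/rcosetsP: (valP C) => h _ E; rewrite (orbE E) -actM; apply: orbE.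
by rewrite /= E rcosetE rcosetM.
Qed.

Definition orbit_map : gmap (gorbit K) X := GMap orbJ.

Lemma orbit_map_inj : injective orbit_map.
Proof.
move=> C D /=.
case/rcosetsP: (valP C) => g _ EC; case/rcosetsP: (valP D) => h _ ED.
rewrite (orbE EC) (orbE ED) => E; apply: val_inj; rewrite EC ED.
apply/rcoset_eqP; rewrite mem_rcoset; apply/astab1P.
by rewrite actM E -actM mulgV act1.
Qed.

Lemma orbit_map_act g : exists C, orbit_map C = gact X x0 g.
Proof.
have H : (K :* g)%g \in rcosets K [set: gT].
  by apply/rcosetsP; exists g; rewrite ?inE.
by exists (exist _ (K :* g)%g H); apply: orbE.
Qed.

Definition coorbitP (x : X) : bool := x \notin orbit (gact X) [set: gT] x0.
Fact coorbitJ x g : coorbitP x -> coorbitP (gact X x g).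
Proof.
apply: contra => /orbitP [h _ E].
apply/orbitP; exists (h * g^-1)%g; rewrite ?inE //.
by rewrite actM E actK.
Qed.
Definition coorbit : gset gT := gsub coorbitJ.

Lemma orbit_coprod : is_coprod orbit_map (gsub_val coorbitJ).
Proof.
have in_orb C : orbit_map C \in orbit (gact X) [set: gT] x0.
  by apply: mem_orbit; rewrite inE.
apply: inj_surj_bij => [[C|u] [D|v] /= E|x].
- by congr inl; apply: orbit_map_inj.
- by have := valP v; rewrite /coorbitP /= -E in_orb.
- by have := valP u; rewrite /coorbitP /= E in_orb.
- by congr inr; apply: val_inj.
have := boolP (coorbitP x); case=> Hx; first by exists (inr (exist _ x Hx)).
move: Hx; rewrite negbK => /orbitP [g _ <-].
by have [C EC] := orbit_map_act g; exists (inl C).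
Qed.

Lemma card_coorbit : (#|coorbit| < #|X|)%N.
Proof.
rewrite /= card_sig; apply/proper_card/properP; split; first exact/subset_predT.
by exists x0; rewrite // inE /coorbitP orbit_refl.
Qed.
End Orbits.

(** A transfer from [X] is the sum of a transfer from one orbit and a transfer
from the complement, which is smaller. *)
Lemma Tr_orbit_ind gT (T : tambara gT) (Y : gset gT) (P : T Y -> Prop) :
  P 0 -> (forall x y, P x -> P y -> P (x + y)) ->
  forall (X : gset gT) (f : gmap X Y) (z : T X),
    (forall (K : {group gT}) (i : gmap (gorbit K) X),
       P (Tr (gmap_comp f i) (Res i z))) ->
    P (Tr f z).
Proof.
move=> P0 PD X; have [n] := ubnP #|X|; elim: n X => // n IH X leX f z Pz.
case: (pickP X) => [x0 _|X0]; last first.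
  by rewrite Tr_empty // => x; have := X0 x.
rewrite (Tr_split _ _ (orbit_coprod x0)); apply: PD; first exact: Pz.
apply: IH; first exact: leq_trans (card_coorbit x0) leX.
move=> K i; rewrite -Res_comp; set j := gsub_val _.
by rewrite (@Tr_ext _ _ _ _ _ (gmap_comp f (gmap_comp j i))).
Qed.

(** * Finite generation *)

Lemma Res_finite gT (T : tambara gT) (X Y : gset gT) (f : gmap X Y) :
  fg_Zalgebra T X ->
  exists l, forall x, lin_span (fun z : T X => exists a, z = Res f a) l x.
Proof.
move=> [n [s gen_s]]; pose S (z : T X) := exists a : T Y, z = Res f a.
have S1 : S 1 by exists 1; rewrite Res1.
have SN a : S a -> S (- a).
  by move=> [b ->]; exists (- b); rewrite ResN.
have SM a b : S a -> S b -> S (a * b).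
  by move=> [a' ->] [b' ->]; exists (a' * b'); rewrite ResM.
have [x _|l [[l1 lM] l_s]] :=
  @finite_of_integral _ S S1 SM [seq s i | i <- enum 'I_n].
  have [m [c xm]] := Res_integral f x.
  by exists m, (fun i => Res f (c i)); split=> // i; exists (c i).
exists l => x.
elim: {x} (gen_s x) => [i||| x y _ lx _ ly|x y _ lx E|x y _ lx _ ly].
- by apply: l_s; apply: map_f; rewrite mem_enum.
- exact: span0.
- exact: l1.
- exact: spanD.
- have -> : y = - x by apply: (addrI x); rewrite subrr.
  exact: spanN.
- exact: (span_mul SM lM).
Qed.

Section Subring.
Variables (gT : finGroupType) (T : tambara gT) (X : gset gT).

Definition subring (G : T X -> Prop) : Prop :=
  [/\ G 0, G 1, forall x y, G x -> G y -> G (x + y),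
      forall x, G x -> G (- x) & forall x y, G x -> G y -> G (x * y)].

Lemma subring_gen_subring I (s : I -> T X) : subring (subring_gen s).
Proof.
split; [exact: sg_zero|exact: sg_one|exact: sg_add| |exact: sg_mul].
by move=> x Hx; apply: (sg_opp Hx); apply: subrr.
Qed.

(** Quantifying over all subrings containing a list allows generating lists to
be enlarged and combined without tracking indices. *)
Lemma fg_of_subring (L : seq (T X)) :
  (forall G, subring G -> (forall x, x \in L -> G x) -> forall x, G x) ->
  fg_Zalgebra T X.
Proof.
move=> H; exists (size L), (fun i => L`_i); apply: H => [|x /(nthP 0) [i lti <-]].
  exact: subring_gen_subring.
exact: (sg_gen _ (Ordinal lti)).
Qed.
End Subring.

Lemma hom_subring gT (T B : tambara gT) (h : tambara_hom T B) (X : gset gT) :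
  fg_Zalgebra T X -> exists L : seq (B X), forall G, subring G ->
    (forall x, x \in L -> G x) -> forall a, G (h X a).
Proof.
move=> [n [s gen_s]]; exists [seq h X (s i) | i <- enum 'I_n] => G.
move=> [G0 G1 GD GN GM] GL a.
elim: {a} (gen_s a) => [i||| x y _ lx _ ly|x y _ lx E|x y _ lx _ ly].
- by apply: GL; apply: map_f; rewrite mem_enum.
- by rewrite -[st_zero T X]/(0 : T X) hom0.
- by rewrite -[st_one T X]/(1 : T X) hom1.
- by rewrite -[st_add x y]/(x + y) homD; apply: GD.
- have -> : y = - x by apply: (addrI x); rewrite subrr.
  by rewrite homN; apply: GN.
- by rewrite -[st_mul x y]/(x * y) homM; apply: GM.
Qed.

Section Transfers.
Variables (gT : finGroupType) (T R B : tambara gT).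
Variables (iT : tambara_hom T B) (iR : tambara_hom R B).

(** With [a] and [b] expanded over finite spanning lists of [T X] and [R X],
Frobenius reciprocity moves the coefficients out of the transfer. *)
Lemma Tr_finite (X Y : gset gT) (f : gmap X Y) :
  fg_Zalgebra T X -> fg_Zalgebra R X -> exists L : seq (B Y),
    forall G, subring G -> (forall a, G (iT Y a)) -> (forall b, G (iR Y b)) ->
    (forall x, x \in L -> G x) ->
    forall a b, G (Tr f (iT X a * iR X b)).
Proof.
move=> /(Res_finite f) [l Hl] /(Res_finite f) [m Hm].
exists [seq Tr f (iT X a * iR X b) | a <- l, b <- m].
move=> G [G0 G1 GD GN GM] GT GR GL a b.
elim: {a} (Hl a) => [|_ y x [a ->] yl _ IH]; first by rewrite hom0 mul0r Tr0.
rewrite homD homM mulrDl TrD; apply: (GD) => //.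
rewrite hom_Res -mulrA mulrC Tr_Res; apply: (GM) => //.
elim: {b IH} (Hm b) => [|_ z t [b ->] zm _ IH]; first by rewrite hom0 mulr0 Tr0.
rewrite homD homM mulrDr TrD; apply: (GD) => //.
rewrite hom_Res mulrCA mulrC Tr_Res; apply: (GM) => //.
by apply: GL; apply: allpairs_f.
Qed.
End Transfers.

Theorem theoremE (gT : finGroupType) (T R B : tambara gT)
    (iT : tambara_hom T B) (iR : tambara_hom R B) :
  is_box_product iT iR ->
  levelwise_fg T -> levelwise_fg R -> levelwise_fg B.
Proof.
move=> box fgT fgR H; set Y := gorbit H.
have [LT HT] := hom_subring iT (fgT H); have [LR HR] := hom_subring iR (fgR H).
(* Maps of [G]-sets do not form a finite type, so the finitely many transfers
   are indexed by the underlying finite functions [h]. *)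
have fin K (h : {ffun gorbit K -> Y}) : exists L : seq (B Y),
    forall g : gmap (gorbit K) Y, g =1 h ->
    forall G, subring G -> (forall a, G (iT Y a)) -> (forall b, G (iR Y b)) ->
    (forall x, x \in L -> G x) ->
    forall a b, G (Tr g (iT _ a * iR _ b)).
  have [[g Eg]|no_g] := EM (exists g : gmap (gorbit K) Y, g =1 h); last first.
    by exists [::] => g Eg; case: no_g; exists g.
  have [L HL] := Tr_finite iT iR g (fgT K) (fgR K).
  exists L => g' Eg' G sG GT GR GL a b.
  by rewrite (@Tr_ext _ _ _ _ _ g) => [|x]; [apply: HL | rewrite Eg].
have finK K : exists L : seq (B Y),
    forall g : gmap (gorbit K) Y,
    forall G, subring G -> (forall a, G (iT Y a)) -> (forall b, G (iR Y b)) ->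
    (forall x, x \in L -> G x) ->
    forall a b, G (Tr g (iT _ a * iR _ b)).
  have [L HL] := fin_all_exists (fin K).
  exists (flatten [seq L h | h <- enum {ffun gorbit K -> Y}]) => g G sG GT GR GL.
  apply: (HL [ffun x => g x]) => // [x|x Hx]; first by rewrite ffunE.
  by apply: GL; apply/flatten_mapP; exists [ffun x => g x]; rewrite ?mem_enum.
have [L HL] := fin_all_exists finK.
apply: (@fg_of_subring _ _ _
          (LT ++ LR ++ flatten [seq L K | K <- enum {group gT}])).
move=> G sG GL z.
have GT a : G (iT Y a).
  by apply: HT => // x Hx; apply: GL; rewrite mem_cat Hx.
have GR b : G (iR Y b).
  by apply: HR => // x Hx; apply: GL; rewrite !mem_cat Hx orbT.
have [X [f [a [b ->]]]] := box_generated box z.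
case: (sG) => G0 _ GD _ _.
apply: Tr_orbit_ind => // K i; rewrite ResM -!hom_Res; apply: HL => // x Hx.
apply: GL; rewrite !mem_cat; apply/orP; right; apply/orP; right.
by apply/flatten_mapP; exists K; rewrite ?mem_enum.
Qed.
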